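(* Let $p,q$ be primes, let $\Gamma<\mathrm{SL}_2(\mathbb{Q}_p)\times\mathrm{SL}_2(\mathbb{Q}_q)$ be an irreducible lattice and let $\Delta<\Gamma$ be a non-central lV-boomerang subgroup. Then $\Delta$ has dense projections, i.e. the projections of $\Delta$ to $\mathrm{SL}_2(\mathbb{Q}_p)$ and to $\mathrm{SL}_2(\mathbb{Q}_q)$ are dense.
   Context: A subgroup $\Delta$ of a countable discrete group $\Gamma$ is an lV-boomerang (lower Vietoris boomerang) subgroup of $\Gamma$ if for every $\gamma\in\Gamma$ and every finite subset $F\subset\Delta$ there are infinitely many integers $n\ge 1$ with $F\subset \gamma^n\Delta\gamma^{-n}$. A lattice in the product is irreducible if its projection to each of the two factors is dense. *)

(* Defs.v *)
From HB Require Import structures.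
From mathcomp Require Import all_boot all_order all_algebra.
From mathcomp Require Import all_classical all_reals all_analysis.

Set Implicit Arguments.
Unset Strict Implicit.
Unset Printing Implicit Defensive.

Import Order.TTheory GRing.Theory Num.Theory.

Local Open Scope classical_set_scope.
Local Open Scope ring_scope.

(* Z_p is the inverse limit of the rings Z/p^n Z. The component in Z/p^n Z is
   represented by its canonical representative [residue x n < p ^ n]; this
   bound is a consequence of the compatibility condition. The proof that p is
   prime is a phantom argument: it is only used for the ring instances. *)
Record padic_int (p : nat) (hp : prime p) := PadicInt {
  residue :> nat -> nat;
  residue_compat : forall n, residue n = (residue n.+1 %% p ^ n)%N }.

Section PadicIntRing.
Context (p : nat) (hp : prime p).
Local Notation Zp := (padic_int hp).

HB.instance Definition _ := gen_eqMixin Zp.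
HB.instance Definition _ := gen_choiceMixin Zp.

Lemma padic_intP (x y : Zp) : (forall n, x n = y n) -> x = y.
Proof.
case: x y => x xP [y yP] /= /funext exy; subst y.
by congr PadicInt; exact: Prop_irrelevance.
Qed.

Lemma residue_mod (x : Zp) n : (x n %% p ^ n)%N = x n.
Proof. by rewrite residue_compat modn_mod. Qed.

Lemma residue_modS (x : Zp) n : x n.+1 = x n %[mod (p ^ n)%N].
Proof. by rewrite residue_mod -residue_compat. Qed.

Fact of_seq_subproof (u : nat -> nat) :
  (forall n, u n.+1 = u n %[mod (p ^ n)%N]) ->
  forall n, (u n %% p ^ n)%N = ((u n.+1 %% p ^ n.+1) %% p ^ n)%N.
Proof. by move=> uP n; rewrite modn_dvdm ?uP// dvdn_exp2l. Qed.

Definition of_seq u (uP : forall n, u n.+1 = u n %[mod (p ^ n)%N]) : Zp :=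
  PadicInt hp (of_seq_subproof uP).

Fact addZp_subproof (x y : Zp) n :
  (x n.+1 + y n.+1)%N = (x n + y n)%N %[mod (p ^ n)%N].
Proof. by rewrite -modnDm !residue_modS modnDm. Qed.

Fact mulZp_subproof (x y : Zp) n :
  (x n.+1 * y n.+1)%N = (x n * y n)%N %[mod (p ^ n)%N].
Proof. by rewrite -modnMm !residue_modS modnMm. Qed.

Lemma residue_le (x : Zp) n : (x n <= p ^ n)%N.
Proof. by rewrite ltnW// -residue_mod ltn_mod expn_gt0 prime_gt0. Qed.

Fact oppZp_subproof (x : Zp) n :
  (p ^ n.+1 - x n.+1)%N = (p ^ n - x n)%N %[mod (p ^ n)%N].
Proof.
apply/eqP; rewrite -(eqn_modDr (x n.+1)) subnK ?residue_le//.
rewrite -modnDmr residue_modS modnDmr subnK ?residue_le//.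
by rewrite modnn expnS modnMl.
Qed.

Definition addZp x y := of_seq (addZp_subproof x y).
Definition mulZp x y := of_seq (mulZp_subproof x y).
Definition oppZp x := of_seq (oppZp_subproof x).
Definition zeroZp := @of_seq (fun=> 0%N) (fun=> erefl).
Definition oneZp := @of_seq (fun=> 1%N) (fun=> erefl).

Fact addZpA : associative addZp.
Proof. by move=> x y z; apply: padic_intP => n /=; rewrite modnDml modnDmr addnA. Qed.

Fact addZpC : commutative addZp.
Proof. by move=> x y; apply: padic_intP => n /=; rewrite addnC. Qed.

Fact add0Zp : left_id zeroZp addZp.
Proof. by move=> x; apply: padic_intP => n /=; rewrite mod0n residue_mod. Qed.

Fact addNZp : left_inverse zeroZp oppZp addZp.
Proof.
by move=> x; apply: padic_intP => n /=; rewrite modnDml subnK ?residue_le// modnn mod0n.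
Qed.

HB.instance Definition _ := GRing.isZmodule.Build Zp addZpA addZpC add0Zp addNZp.

Fact mulZpA : associative mulZp.
Proof. by move=> x y z; apply: padic_intP => n /=; rewrite modnMml modnMmr mulnA. Qed.

Fact mulZpC : commutative mulZp.
Proof. by move=> x y; apply: padic_intP => n /=; rewrite mulnC. Qed.

Fact mul1Zp : left_id oneZp mulZp.
Proof. by move=> x; apply: padic_intP => n /=; rewrite modnMml mul1n residue_mod. Qed.

Fact mulZpDl : left_distributive mulZp addZp.
Proof.
by move=> x y z; apply: padic_intP => n /=; rewrite modnMml modnDm mulnDl.
Qed.

Fact oneZp_neq0 : oneZp != zeroZp.
Proof.
apply/eqP => /(congr1 (fun x : Zp => x 1%N)) /=.
by rewrite expn1 mod0n modn_small// prime_gt1.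
Qed.

HB.instance Definition _ :=
  GRing.Zmodule_isComNzRing.Build Zp mulZpA mulZpC mul1Zp mulZpDl oneZp_neq0.

Definition unitZp : {pred Zp} := fun x => `[< exists y : Zp, y * x = 1 >].
Definition invZp (x : Zp) : Zp := xget x [set y | y * x = 1].

Fact mulVZp : {in unitZp, left_inverse 1 invZp *%R}.
Proof. by move=> x /asboolP ux; exact: (xgetPex x ux). Qed.

Fact unitZpPl (x y : Zp) : y * x = 1 -> unitZp x.
Proof. by move=> yx1; apply/asboolP; exists y. Qed.

Fact invZp_out : {in [predC unitZp], invZp =1 id}.
Proof.
move=> x /negP nux; rewrite /invZp; case: xgetP => // y _ yx1.
by case: nux; exact: unitZpPl yx1.
Qed.

HB.instance Definition _ :=
  GRing.ComNzRing_hasMulInverse.Build Zp mulVZp unitZpPl invZp_out.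

Lemma residue_ltn_mod (x : Zp) m n : (m <= n)%N -> (x n %% p ^ m)%N = x m.
Proof.
elim: n => [|n IHn]; first by rewrite leqn0 => /eqP ->; rewrite residue_mod.
rewrite leq_eqVlt => /predU1P[->|/[!ltnS] mn]; first exact: residue_mod.
by rewrite -(modn_dvdm _ (dvdn_exp2l p mn)) -residue_compat IHn.
Qed.

Lemma padic_int_neq0 (x : Zp) : x != 0 -> exists k, x k != 0%N.
Proof.
move=> x0; apply: contrapT => /forallNP xk; case/eqP: x0.
by apply: padic_intP => n /=; rewrite mod0n; apply/eqP/negPn/negP/xk.
Qed.

Fact mulZp_integral : GRing.integral_domain_axiom Zp.
Proof.
move=> x y xy0; apply/norP => -[/padic_int_neq0[k xk] /padic_int_neq0[l yl]].
have : (x (k + l)%N * y (k + l)%N %% p ^ (k + l))%N = 0%N.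
  by move/(congr1 (fun x : Zp => x (k + l)%N)): xy0 => /=; rewrite mod0n.
have {}xk : ~~ (p ^ k %| x (k + l)%N)%N by rewrite /dvdn residue_ltn_mod ?leq_addr.
have {}yl : ~~ (p ^ l %| y (k + l)%N)%N by rewrite /dvdn residue_ltn_mod ?leq_addl.
have x0 : (0 < x (k + l)%N)%N by case: (x _) xk => //; rewrite dvdn0.
have y0 : (0 < y (k + l)%N)%N by case: (y _) yl => //; rewrite dvdn0.
move/eqP; rewrite -/(dvdn _ _) pfactor_dvdn// ?muln_gt0 ?x0// lognM//.
move: xk yl; rewrite !pfactor_dvdn// -!ltnNge => xk yl.
by rewrite leqNgt -addnS leq_add// ltnW.
Qed.

HB.instance Definition _ := GRing.ComUnitRing_isIntegral.Build Zp mulZp_integral.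

End PadicIntRing.

Definition padic (p : nat) (hp : prime p) := {fraction padic_int hp}.

Section PadicTopology.
Context (p : nat) (hp : prime p).
Local Notation Qp := (padic hp).
Local Notation tofrac := (@FracField.tofrac (padic_int hp)).

HB.instance Definition _ := GRing.Field.on Qp.

Definition padic_ball (x : Qp) (n : nat) : set Qp :=
  [set x + p%:R ^+ n * tofrac z | z in [set: padic_int hp]].

Definition padic_nbhs (x : Qp) : set_system Qp :=
  filter_from [set: nat] (padic_ball x).

HB.instance Definition _ := hasNbhs.Build Qp padic_nbhs.

Lemma padic_ball_center x n : padic_ball x n x.
Proof. by exists 0 => //; rewrite tofrac0 mulr0 addr0. Qed.

Lemma padic_ball_trans x y z n :
  padic_ball x n y -> padic_ball y n z -> padic_ball x n z.
Proof.
by move=> [a _ <-] [b _ <-]; exists (a + b) => //; rewrite tofracD mulrDr addrA.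
Qed.

Lemma padic_ball_le x m n : (m <= n)%N -> padic_ball x n `<=` padic_ball x m.
Proof.
move=> mn _ [a _ <-]; exists (p%:R ^+ (n - m) * a) => //.
by rewrite tofracM tofracXn tofracMn tofrac1 mulrA -exprD subnKC.
Qed.

Fact padic_nbhs_filter (x : Qp) : ProperFilter (nbhs x).
Proof.
apply: filter_from_proper => [|n _]; last by exists x; exact: padic_ball_center.
apply: filter_from_filter; first by exists 0%N.
move=> m n _ _; exists (maxn m n) => // y xy.
by split; apply: padic_ball_le xy; rewrite ?leq_maxl ?leq_maxr.
Qed.

Fact padic_nbhs_singleton (x : Qp) A : nbhs x A -> A x.
Proof. by move=> [n _]; apply; exact: padic_ball_center. Qed.

Fact padic_nbhs_nbhs (x : Qp) A : nbhs x A -> nbhs x (nbhs^~ A).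
Proof.
move=> [n _ xA]; exists n => // y xy; exists n => // z yz.
exact: xA (padic_ball_trans xy yz).
Qed.

HB.instance Definition _ := Nbhs_isNbhsTopological.Build Qp
  padic_nbhs_filter padic_nbhs_singleton padic_nbhs_nbhs.
HB.instance Definition _ := isPointed.Build Qp 0.

End PadicTopology.

Record SL (n : nat) (K : comUnitRingType) := MkSL {
  SL_mx :> 'M[K]_n;
  SL_det : \det SL_mx == 1 }.

HB.instance Definition _ n K := [isSub for @SL_mx n K].
HB.instance Definition _ n K := [Choice of SL n K by <:].

Section SLGroup.
Context (n : nat) (K : comUnitRingType).
Implicit Types A B : SL n K.

Fact SL1_subproof : \det (1%:M : 'M[K]_n) == 1.
Proof. by rewrite det1. Qed.

Fact SLM_subproof A B : \det (A *m B) == 1.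
Proof. by rewrite det_mulmx (eqP (SL_det A)) (eqP (SL_det B)) mul1r. Qed.

Fact SLV_subproof A : \det (invmx A) == 1.
Proof. by rewrite det_inv (eqP (SL_det A)) invr1. Qed.

Definition SL1 : SL n K := MkSL SL1_subproof.
Definition SLM A B : SL n K := MkSL (SLM_subproof A B).
Definition SLV A : SL n K := MkSL (SLV_subproof A).

Lemma SL_unitmx A : (A : 'M[K]_n) \in unitmx.
Proof. by rewrite unitmxE (eqP (SL_det A)) unitr1. Qed.

Fact SLMA : associative SLM.
Proof. by move=> A B C; apply: val_inj; rewrite /= mulmxA. Qed.

Fact SL1M : left_id SL1 SLM.
Proof. by move=> A; apply: val_inj; rewrite /= mul1mx. Qed.

Fact SLM1 : right_id SL1 SLM.
Proof. by move=> A; apply: val_inj; rewrite /= mulmx1. Qed.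

Fact SLVM : left_inverse SL1 SLV SLM.
Proof. by move=> A; apply: val_inj; rewrite /= mulVmx ?SL_unitmx. Qed.

Fact SLMV : right_inverse SL1 SLV SLM.
Proof. by move=> A; apply: val_inj; rewrite /= mulmxV ?SL_unitmx. Qed.

HB.instance Definition _ := isGroup.Build (SL n K) SLMA SL1M SLM1 SLVM SLMV.
HB.instance Definition _ := isPointed.Build (SL n K) 1%g.

End SLGroup.

HB.instance Definition _ n (p : nat) (hp : prime p) :=
  Topological.copy (SL n (padic hp))
    (initial_topology (@SL_mx n (padic hp))).

(* Groups carrying a topology; as for [PreTopologicalLmodule], no
   compatibility between the two structures is required. *)
#[short(type="preTopologicalGroupType")]
HB.structure Definition PreTopologicalGroup :=
  {G of Group G & PointedTopological G}.

HB.instance Definition _ n (p : nat) (hp : prime p) :=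
  Group.on (SL n (padic hp)).
HB.instance Definition _ (G H : preTopologicalGroupType) :=
  Group.on (G * H)%type.

Section CosetSpace.
Local Open Scope quotient_scope.
Context (G : preTopologicalGroupType) (Gamma : groupClosed G).

(* x Gamma = y Gamma *)
Definition same_lcoset : rel G := fun x y => (x^-1 * y)%g \in Gamma.

Fact same_lcoset_refl : reflexive same_lcoset.
Proof. by move=> x; rewrite /same_lcoset mulVg gpred1. Qed.

Fact same_lcoset_sym : symmetric same_lcoset.
Proof. by move=> x y; rewrite /same_lcoset -gpredV invgM invgK. Qed.

Fact same_lcoset_trans : transitive same_lcoset.
Proof.
by move=> y x z xy yz; have := gpredM _ _ xy yz; rewrite /same_lcoset mulgA mulgK.
Qed.

Canonical same_lcoset_equiv :=
  EquivRel same_lcoset same_lcoset_refl same_lcoset_sym same_lcoset_trans.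

Definition coset_space := quotient_topology {eq_quot same_lcoset}.
HB.instance Definition _ := PointedTopological.on coset_space.
HB.instance Definition _ := Quotient.on coset_space.

Definition coset_act (g : G) (c : coset_space) : coset_space :=
  \pi_coset_space (g * repr c)%g.

Lemma coset_act_pi (g x : G) :
  coset_act g (\pi_coset_space x) = \pi_coset_space (g * x)%g.
Proof.
apply/eqmodP; rewrite /= /same_lcoset invgM -mulgA mulKg.
by rewrite -/(same_lcoset _ _); apply/eqmodP; rewrite reprK.
Qed.

Definition borel_coset_space := g_sigma_algebraType (@open coset_space).

End CosetSpace.

Definition is_discrete_subgroup (G : preTopologicalGroupType)
    (Gamma : groupClosed G) : Prop :=
  [set` Gamma] `<=` isolated [set` Gamma].

(* G / Gamma carries a nonzero finite G-invariant Borel measure. Regularity is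
   automatic in the locally compact second countable case. *)
Definition is_lattice (R : realType) (G : preTopologicalGroupType)
    (Gamma : groupClosed G) : Prop :=
  is_discrete_subgroup Gamma /\
  exists mu : {measure set (borel_coset_space Gamma) -> \bar R},
    [/\ (0 < mu setT)%E, (mu setT < +oo)%E &
        forall (g : G) (A : set (borel_coset_space Gamma)), measurable A ->
          mu (coset_act g @` A) = mu A].

Definition irreducible (G H : preTopologicalGroupType)
    (Gamma : groupClosed (G * H)%type) : Prop :=
  dense (fst @` [set` Gamma]) /\ dense (snd @` [set` Gamma]).

Section Boomerang.
Context (G : groupType) (Gamma Delta : groupClosed G).

Definition central : Prop :=
  forall d g, d \in Delta -> g \in Gamma -> commute d g.

Definition lV_boomerang : Prop :=
  forall gamma, gamma \in Gamma ->
  forall F : set G, finite_set F -> F `<=` [set` Delta] ->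
  infinite_set [set n : nat | (1 <= n)%N /\
    F `<=` [set (gamma ^+ n * d * gamma ^- n)%g | d in [set` Delta]]].

End Boomerang.

(* Main.v *)
Require Import Defs.
From HB Require Import structures.
From mathcomp Require Import all_boot all_order all_algebra.
From mathcomp Require Import ring zify.
From mathcomp Require Import all_classical all_reals all_analysis.

(** Let L and D be the projections of Gamma and Delta to one factor SL_2(Q_p).
    Then L is dense, and D is a recurrent subgroup: for g in L and x in D the
    conjugate g ^- n x g ^ n lies in D for infinitely many n. The heart of the proof
    is [dense_of_nonscalar]: such a D is dense as soon as it contains a nonscalar h.

    The closure of D is shown to contain enough unipotents.
    - [exists_hyperbolic], [diagonalize]: by density L contains a hyperbolic g
      with two eigenlines in Q_p ^ 2, neither of them fixed by h. After a
      conjugation, g = diag(l, 1/l) with l small, and h 0 1 and h 1 0 are nonzero.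
    - [exists_small_with_upper_entry]: D contains elements x arbitrarily close to
      1 with x 0 1 != 0, namely commutators of h with powers of elements of L that
      are close to 1.
    - [upper_unipotent]: conjugating such an x by g ^ m multiplies its entry 0 1 by
      l ^ (- 2 m) and its entry 1 0 by l ^ (2 m). Recurrence allows m to be large,
      so the result is an upper unipotent matrix with a huge entry 0 1, up to a
      small error. Raising it to the power p again and again divides the size of
      this entry by p each time and moves the other entries very little, so every
      size is reached; hence every upper unipotent matrix is a limit of such powers.
    - [upper_unipotents_generate]: the upper unipotent matrices and h generate
      SL_2, since h 1 0 != 0.

    That D contains a nonscalar element comes from the discreteness of Gamma
    ([dense_projection]): otherwise some d in Delta has a scalar component in this
    factor and a nonscalar one in the other, and suitable commutators of d with
    elements of Gamma are nontrivial, trivial in this factor and arbitrarily close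
    to 1 in the other. *)

Set Implicit Arguments.
Unset Strict Implicit.
Unset Printing Implicit Defensive.

Import Order.TTheory GRing.Theory Num.Theory.

Local Open Scope classical_set_scope.
Local Open Scope ring_scope.

(** * Inverses and fixed points in the p-adic integers *)

Section PadicIntegers.
Context (p : nat) (hp : prime p).
Local Notation Zp := (padic_int hp).

Lemma residueD (x y : Zp) n : (x + y) n = ((x n + y n) %% p ^ n)%N.
Proof. by []. Qed.

Lemma residueM (x y : Zp) n : (x * y) n = ((x n * y n) %% p ^ n)%N.
Proof. by []. Qed.

Lemma residue_nat m n : (m%:R : Zp) n = (m %% p ^ n)%N.
Proof.
elim: m => [|m IH]; first by [].
by rewrite -natr1 residueD IH /= modnDml modnDmr addn1.
Qed.

Lemma residue_mulpX (x : Zp) n : (p%:R ^+ n * x) n = 0%N.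
Proof. by rewrite -natrX residueM residue_nat modnn mul0n mod0n. Qed.

Lemma residue_sub0 (x y : Zp) n : x n = y n -> (x - y) n = 0%N.
Proof.
move=> e; have : (x - y + y) n = y n by rewrite subrK.
rewrite residueD -{2}(residue_mod y n) -{2}[y n]add0n => /eqP.
by rewrite eqn_modDr mod0n residue_mod => /eqP.
Qed.

Lemma residue_dvd (x : Zp) n : x n = 0%N -> exists y : Zp, x = p%:R ^+ n * y.
Proof.
move=> xn0.
have pn0 k : (0 < p ^ k)%N by rewrite expn_gt0 prime_gt0.
have dv m : (p ^ n %| x (m + n))%N.
  by rewrite /dvdn residue_ltn_mod ?leq_addl// xn0.
have uP m : (x (m.+1 + n) %/ p ^ n)%N = (x (m + n) %/ p ^ n)%N %[mod (p ^ m)%N].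
  apply/eqP; rewrite -(@eqn_pmul2r (p ^ n)) // !muln_modl -expnD.
  by rewrite !divnK// addSn residue_modS.
exists (of_seq hp uP); apply: padic_intP => m.
rewrite -natrX residueM residue_nat modnMml /= modnMmr.
by rewrite mulnC divnK// residue_ltn_mod// leq_addr.
Qed.

(** The iterates of 0 stabilise modulo p ^ n after n steps, so their residues
    form a compatible sequence. Both inversion and Hensel lifting below are
    instances. *)
Lemma contraction_fixpoint (f : Zp -> Zp) :
  (forall (x y : Zp) n, x n = y n -> f x n.+1 = f y n.+1) -> exists x, f x = x.
Proof.
move=> cf; pose u n := iter n f 0.
have z0 (x : Zp) : x 0%N = 0%N by rewrite -residue_mod expn0 modn1.
have uS n : u n.+1 n = u n n.
  elim: n => [|n IH]; first by rewrite !z0.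
  exact: cf.
have uP n : u n.+1 n.+1 = u n n %[mod (p ^ n)%N].
  by rewrite residue_modS uS.
exists (of_seq hp uP); apply: padic_intP => -[|n]; first by rewrite !z0.
by rewrite (cf _ (u n))/= residue_mod.
Qed.

(** The inverse is the fixed point of z |-> 1 + p y z. *)
Lemma inverse_1Bp (y : Zp) : exists z : Zp, z * (1 - p%:R * y) = 1.
Proof.
have [|z zE] := @contraction_fixpoint (fun z => 1 + p%:R * y * z).
  move=> a b n ab; rewrite !residueD; congr ((_ + _) %% _)%N.
  have [c cE] := residue_dvd (residue_sub0 ab).
  have -> : p%:R * y * a = p%:R * y * b + p%:R ^+ n.+1 * (y * c) :> Zp.
    by rewrite exprS -[in LHS](subrK b a) cE; ring.
  by rewrite residueD residue_mulpX addn0 residue_mod.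
exists z; rewrite mulrBr mulr1 -{1}zE; ring.
Qed.

(** An inverse u of x modulo p turns x into u x = 1 + p c. *)
Lemma inverse_of_residue (x : Zp) : x 1%N != 0%N -> exists y : Zp, y * x = 1.
Proof.
move=> x1.
have cop : coprime p (x 1%N).
  rewrite prime_coprime//; apply/negP => /dvdnP[k kE].
  by move: x1; rewrite -residue_mod expn1 kE modnMl.
have [|u v uv _] := egcdnP p (m := x 1%N); first by rewrite lt0n.
move: (uv); rewrite gcdnC (eqP cop) => uE.
have [|c cE] := @residue_dvd (u%:R * x - 1) 1.
  apply: residue_sub0; rewrite residueM residue_nat modnMml uE.
  by rewrite expn1 modnMDl /= expn1.
have [z zE] := inverse_1Bp (- c).
exists (z * u%:R).
rewrite -mulrA -[u%:R * x](subrK 1) cE -[RHS]zE; ring.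
Qed.

Lemma padic_int_factor (x : Zp) : x != 0 ->
  exists k (u v : Zp), v * u = 1 /\ x = p%:R ^+ k * u.
Proof.
move=> /padic_int_neq0 ex; case: (ex_minnP ex) => -[|k] xk kmin.
  by move: xk; rewrite -residue_mod expn0 modn1.
have [|u uE] := @residue_dvd x k.
  by apply/eqP/negPn/negP => /kmin; rewrite ltnn.
have [|v vE] := @inverse_of_residue u; last by exists k, u, v.
apply: contra xk => /eqP u1.
have [w wE] : exists w : Zp, u = p%:R ^+ 1 * w by apply: residue_dvd.
have -> : x = p%:R ^+ k.+1 * w by rewrite uE wE expr1 mulrA -exprSr.
by rewrite residue_mulpX.
Qed.

Lemma padic_int_natr_approx (x : Zp) n : exists (t : nat) (z : Zp), x - t%:R = p%:R ^+ n * z.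
Proof.
exists (x n).
by apply: residue_dvd; apply: residue_sub0; rewrite residue_nat residue_mod.
Qed.

End PadicIntegers.

(** * Orders of magnitude and valuations in the p-adic field *)

Section PadicOrder.
Context (p : nat) (hp : prime p).
Local Notation Zp := (padic_int hp).
Local Notation Qp := (padic hp).
Local Notation tofrac := (@FracField.tofrac (padic_int hp)).
Local Notation pi := (p%:R : Qp).

(** x = O(p ^ n). The exponent is an integer, since the entries of an element of
    SL_2 are unbounded. *)
Definition inO (n : int) (x : Qp) : Prop := exists z : Zp, x = pi ^ n * tofrac z.

Lemma padic_fraction (x : Qp) :
  exists a b : Zp, b != 0 /\ x = tofrac a / tofrac b.
Proof.
suff [a [b [b0 xE]]] : exists a b : Zp, b != 0 /\ x * tofrac b = tofrac a.
  by exists a, b; split=> //; rewrite -xE mulfK// tofrac_eq0.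
elim/quotW: x => r; exists r.1, r.2.
have r0 : (frac r).2 != 0 by exact: denom_ratioP.
split=> //; rewrite [LHS]piE [RHS]piE.
apply/eqmodP; rewrite /= FracField.equivfE /FracField.mulf.
by rewrite !numden_Ratio ?(oner_eq0, mulf_neq0)// !mulr1 mulrC.
Qed.

Lemma pnat_neq0 : pi != 0.
Proof.
rewrite -(rmorph_nat tofrac) tofrac_eq0.
apply/eqP => /(congr1 (fun x : Zp => x 2%N)).
rewrite residue_nat /= modn_small ?mod0n; first by move=> p0; have := prime_gt0 hp; rewrite p0.
by rewrite -[X in (X < _)%N]expn1 ltn_exp2l ?prime_gt1.
Qed.

Lemma two_neq0 : (2%:R : Qp) != 0.
Proof.
rewrite -(rmorph_nat tofrac) tofrac_eq0.
apply/eqP => /(congr1 (fun x : Zp => x 2%N)).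
rewrite residue_nat /= modn_small ?mod0n//.
by rewrite (@leq_trans (2 ^ 2)) // leq_exp2r // prime_gt1.
Qed.

Lemma inO_tofrac z : inO 0 (tofrac z).
Proof. by exists z; rewrite expr0z mul1r. Qed.

Lemma inO_natr t : inO 0 t%:R.
Proof. by rewrite -(rmorph_nat tofrac); exact: inO_tofrac. Qed.

Lemma inO1 : inO 0 1.
Proof. exact: (inO_natr 1). Qed.

Lemma inO0 n : inO n 0.
Proof. by exists 0; rewrite rmorph0 mulr0. Qed.

Lemma inOD n x y : inO n x -> inO n y -> inO n (x + y).
Proof. by move=> [a ->] [b ->]; exists (a + b); rewrite rmorphD mulrDr. Qed.

Lemma inON n x : inO n x -> inO n (- x).
Proof. by move=> [a ->]; exists (- a); rewrite rmorphN mulrN. Qed.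

Lemma inOB n x y : inO n x -> inO n y -> inO n (x - y).
Proof. by move=> hx hy; apply: inOD => //; exact: inON. Qed.

Lemma inOM m n x y : inO m x -> inO n y -> inO (m + n) (x * y).
Proof.
move=> [a ->] [b ->]; exists (a * b); rewrite rmorphM expfzDr ?pnat_neq0//.
by rewrite mulrACA.
Qed.

Lemma inO_piz n : inO n (pi ^ n).
Proof. by exists 1; rewrite rmorph1 mulr1. Qed.

Lemma inO_le m n x : (m <= n)%R -> inO n x -> inO m x.
Proof.
move=> mn [a ->]; exists (p%:R ^+ `|(n - m)%R|%N * a).
rewrite rmorphM rmorphXn rmorph_nat mulrA exprnP -expfzDr ?pnat_neq0//.
by congr (_ ^ _ * _); rewrite gez0_abs ?subr_ge0// addrC subrK.
Qed.

Lemma inOM_le k m n x y : inO m x -> inO n y -> (k <= m + n)%R -> inO k (x * y).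
Proof. by move=> hx hy kmn; apply: inO_le kmn _; exact: inOM. Qed.

(** The valuation as a relation. Putting the bound on the inverse in the definition
    makes it multiplicative for free, and needs no minimality argument. *)
Definition hasval (v : int) (x : Qp) := [/\ x != 0, inO v x & inO (- v) x^-1].

Lemma hasval_neq0 v x : hasval v x -> x != 0. Proof. by case. Qed.
Lemma hasval_in v x : hasval v x -> inO v x. Proof. by case. Qed.

Lemma hasval_ex x : x != 0 -> exists v, hasval v x.
Proof.
have key (a : Zp) : a != 0 -> exists v, hasval v (tofrac a).
  move=> a0; have [k [u [v [vu aE]]]] := padic_int_factor a0.
  have tvu : tofrac v * tofrac u = 1 by rewrite -rmorphM vu rmorph1.
  have u0 : tofrac u != 0.
    by apply/eqP => u0; move: tvu; rewrite u0 mulr0 => /esym/eqP; rewrite oner_eq0.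
  have tE : tofrac a = pi ^ k%:Z * tofrac u.
    by rewrite aE rmorphM rmorphXn rmorph_nat exprnP.
  exists k%:Z; split; first by rewrite tofrac_eq0.
    by exists u.
  exists v; rewrite tE invfM invr_expz; congr (_ * _).
  by apply: (mulIf u0); rewrite tvu mulVf.
move=> x0; have [a [b [b0 xE]]] := padic_fraction x.
have [|va [ha1 ha2 ha3]] := key a.
  by apply: contra_neq x0 => a0; rewrite xE a0 rmorph0 mul0r.
have [//|vb [hb1 hb2 hb3]] := key b.
exists (va - vb); split=> //; rewrite xE; first exact: inOM.
by rewrite invfM invrK opprB addrC; apply: inOM.
Qed.

Lemma inO_unbounded x : exists n : nat, forall k : nat, (n <= k)%N -> inO (- k%:Z) x.
Proof.
have [->|/hasval_ex[v [_ xv _]]] := eqVneq x 0.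
  by exists 0%N => k _; exact: inO0.
by exists `|v|%N => k nk; apply: inO_le xv; lia.
Qed.

Lemma one_notin1 : ~ inO 1 1.
Proof.
move=> [z]; rewrite expr1z -(rmorph_nat tofrac) -(rmorph1 tofrac) -rmorphM.
move/eqP; rewrite tofrac_eq => /eqP /(congr1 (fun x : Zp => x 1%N)).
by rewrite -[p%:R]expr1 residue_mulpX /= expn1 modn_small// prime_gt1.
Qed.

Lemma hasval_le v w x : hasval v x -> inO w x -> w <= v.
Proof.
move=> [x0 _ xV] xw; rewrite leNgt; apply/negP => vw; apply: one_notin1.
by rewrite -(mulfV x0); apply: inOM_le xw xV _; lia.
Qed.

Lemma hasvalM v w x y : hasval v x -> hasval w y -> hasval (v + w) (x * y).
Proof.
move=> [x0 xv xV] [y0 yv yV]; split; first by rewrite mulf_neq0.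
  exact: inOM.
by rewrite invfM opprD; apply: inOM.
Qed.

Lemma hasvalV v x : hasval v x -> hasval (- v) x^-1.
Proof. by move=> [x0 xv xV]; split; rewrite ?invr_eq0 ?invrK ?opprK. Qed.

Lemma hasval1D y : inO 1 y -> hasval 0 (1 + y).
Proof.
move=> [z]; rewrite expr1z => yE; have [w wE] := inverse_1Bp (- z).
have wE' : tofrac w * (1 + y) = 1.
  rewrite -[RHS](rmorph1 tofrac) -wE mulrN opprK rmorphM rmorphD rmorphM.
  by rewrite rmorph1 rmorph_nat yE.
have y0 : 1 + y != 0.
  by apply/eqP => y0; move: wE'; rewrite y0 mulr0 => /esym/eqP; rewrite oner_eq0.
split=> //.
- by apply: inOD; [exact: inO1|rewrite yE -[p%:R]expr1z; exists (p%:R * z);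
    rewrite expr0z mul1r rmorphM rmorph_nat].
- have -> : (1 + y)^-1 = tofrac w by apply: (mulIf y0); rewrite wE' mulVf.
  exact: inO_tofrac.
Qed.

Lemma hasvalD v x y : hasval v x -> inO (v + 1) y -> hasval v (x + y).
Proof.
move=> xv yv; have x0 := hasval_neq0 xv.
have -> : x + y = x * (1 + y / x) by rewrite mulrDr mulr1 mulrCA mulfV// mulr1.
rewrite -[v]addr0; apply: hasvalM => //; apply: hasval1D.
by case: xv => _ _ xV; apply: inOM_le yv xV _; lia.
Qed.

Lemma hasval_piz n : hasval n (pi ^ n).
Proof.
split; [by rewrite expfz_neq0 ?pnat_neq0|exact: inO_piz|].
by rewrite invr_expz; exact: inO_piz.
Qed.

Lemma hasval_natr s : ~~ (p %| s)%N -> hasval 0 (s%:R : Qp).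
Proof.
move=> ps; have [|v vE] := @inverse_of_residue _ hp s%:R.
  by rewrite residue_nat expn1.
have vE' : tofrac v * s%:R = 1.
  by rewrite -(rmorph_nat tofrac) -rmorphM vE rmorph1.
have s0 : (s%:R : Qp) != 0.
  by apply/eqP => s0; move: vE'; rewrite s0 mulr0 => /esym/eqP; rewrite oner_eq0.
split=> //; first exact: inO_natr.
rewrite oppr0; have -> : (s%:R)^-1 = tofrac v by apply: (mulIf s0); rewrite vE' mulVf.
exact: inO_tofrac.
Qed.

Lemma inO_natr_approx x (n : nat) : inO 0 x -> exists t : nat, inO n%:Z (x - t%:R).
Proof.
move=> [z]; rewrite expr0z mul1r => ->; have [t [y yE]] := padic_int_natr_approx z n.
by exists t, y; rewrite -exprnP -(rmorph_nat tofrac) -rmorphB yE rmorphM rmorphXn rmorph_nat.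
Qed.

(** With s the inverse of a trace tau, a solution l is the small root of
    X ^ 2 - tau X + 1, and the equation is already in the form of a contraction. *)
Lemma hensel_reciprocal s : inO 1 s -> exists l, inO 1 l /\ l = s * (1 + l ^+ 2).
Proof.
move=> [z]; rewrite expr1z => sE.
have [|l lE] := @contraction_fixpoint _ hp (fun x => p%:R * z * (1 + x ^+ 2)).
  move=> a b n ab; have [c cE] := residue_dvd (residue_sub0 ab).
  have -> : p%:R * z * (1 + a ^+ 2) =
      p%:R * z * (1 + b ^+ 2) + p%:R ^+ n.+1 * (z * c * (b + b + p%:R ^+ n * c)).
    by rewrite [_ ^+ n.+1]exprS -[in LHS](subrK b a) cE; ring.
  by rewrite residueD residue_mulpX addn0 residue_mod.
exists (tofrac l); split; last first.
  by rewrite sE -{1}lE !(rmorphM, rmorphD, rmorphXn, rmorph_nat, rmorph1).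
exists (z * (1 + l ^+ 2)).
by rewrite -{1}lE expr1z !(rmorphM, rmorphD, rmorphXn, rmorph_nat, rmorph1) mulrA.
Qed.

End PadicOrder.

(** * Entries of 2 x 2 matrices *)

Section SL2.
Context (K : comUnitRingType).
Implicit Types x y : SL 2 K.

Lemma ord2P (i : 'I_2) : i = 0 \/ i = 1.
Proof. by case: i => -[|[|//]] h; [left|right]; apply: val_inj. Qed.

Lemma det_mx2 (A : 'M[K]_2) : \det A = A 0 0 * A 1 1 - A 0 1 * A 1 0.
Proof.
rewrite (expand_det_row _ 0) !big_ord_recl big_ord0 addr0 /cofactor !det_mx11 !mxE /=.
rewrite addn0 addn1 expr0 expr1 mul1r mulN1r mulrN.
have -> : lift (0 : 'I_2) 0 = 1 by apply: val_inj.
by have -> : lift (1 : 'I_2) 0 = 0 by apply: val_inj.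
Qed.

Lemma SL2_det x : x 0 0 * x 1 1 - x 0 1 * x 1 0 = 1.
Proof. by rewrite -det_mx2 (eqP (SL_det x)). Qed.

Lemma mulmx2 (A B : 'M[K]_2) i j : (A *m B) i j = A i 0 * B 0 j + A i 1 * B 1 j.
Proof.
rewrite mxE !big_ord_recl big_ord0 addr0.
by have -> : lift (0 : 'I_2) 0 = 1 by apply: val_inj.
Qed.

Lemma SL2M x y i j : (x * y)%g i j = x i 0 * y 0 j + x i 1 * y 1 j.
Proof. exact: mulmx2. Qed.

Lemma SL2_1 i j : (1%g : SL 2 K) i j = (i == j)%:R.
Proof. by rewrite mxE. Qed.

Lemma SL2_eq x y : x 0 0 = y 0 0 -> x 0 1 = y 0 1 -> x 1 0 = y 1 0 ->
  x 1 1 = y 1 1 -> x = y.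
Proof.
move=> h00 h01 h10 h11; apply: val_inj; apply/matrixP => i j /=.
by case: (ord2P i) => ->; case: (ord2P j) => ->.
Qed.

Lemma SL2_ex (a b c d : K) : a * d - b * c = 1 -> exists x : SL 2 K,
  [/\ x 0 0 = a, x 0 1 = b, x 1 0 = c & x 1 1 = d].
Proof.
move=> e; pose A : 'M[K]_2 := \matrix_(i, j)
  if i == 0 then (if j == 0 then a else b) else (if j == 0 then c else d).
have dA : \det A == 1 by rewrite det_mx2 !mxE /= e.
by exists (MkSL dA); split; rewrite /= mxE.
Qed.

Lemma SL2V x : [/\ x^-1%g 0 0 = x 1 1, x^-1%g 0 1 = - x 0 1,
  x^-1%g 1 0 = - x 1 0 & x^-1%g 1 1 = x 0 0].
Proof.
have dx := SL2_det x.
have [|y [y0 y1 y2 y3]] := @SL2_ex (x 1 1) (- x 0 1) (- x 1 0) (x 0 0).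
  by rewrite -dx; ring.
suff -> : x^-1%g = y by [].
apply: mulg1_eq; apply: SL2_eq;
  rewrite SL2M SL2_1 ?(y0, y1, y2, y3) /= -?dx; ring.
Qed.

End SL2.

(** * Congruence of matrices and continuity of the group operations *)

Section Congruence.
Context (p : nat) (hp : prime p).
Local Notation Qp := (padic hp).
Local Notation S := (SL 2 (padic hp)).
Local Notation inO := (@inO p hp).
Local Notation pi := (p%:R : Qp).
Implicit Types A B C : 'M[Qp]_2.

(** Congruence of the entries modulo p ^ n. It is stated for matrices rather than
    for SL_2 so that it also describes the topology of the space of matrices. *)
Definition cong n A B := forall i j, inO n (A i j - B i j).

Lemma cong_refl n A : cong n A A.
Proof. by move=> i j; rewrite subrr; exact: inO0. Qed.

Lemma cong_le m n A B : m <= n -> cong n A B -> cong m A B.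
Proof. by move=> mn AB i j; apply: inO_le mn _. Qed.

Lemma cong_trans n A B C : cong n A B -> cong n B C -> cong n A C.
Proof.
by move=> AB BC i j; rewrite -[A i j](subrK (B i j)) -addrA; apply: inOD.
Qed.

Lemma bounded_mx A : exists e : nat, forall k : nat, (e <= k)%N ->
  forall i j, inO (- k%:Z) (A i j).
Proof.
have [a ha] := inO_unbounded (A 0 0); have [b hb] := inO_unbounded (A 0 1).
have [c hc] := inO_unbounded (A 1 0); have [d hd] := inO_unbounded (A 1 1).
exists (a + b + c + d)%N => k hk i j.
by case: (ord2P i) => ->; case: (ord2P j) => ->; [apply: ha|apply: hb|apply: hc|apply: hd]; lia.
Qed.

Lemma cong_mulmx A B (n : nat) : exists m : nat, forall k : nat, (m <= k)%N ->
  forall A' B', cong k A' A -> cong k B' B -> cong n (A' *m B') (A *m B).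
Proof.
have [e he] := bounded_mx A; have [f hf] := bounded_mx B.
exists (n + e + f)%N => k hk A' B' hA hB i j.
have -> : (A' *m B') i j - (A *m B) i j = (A' *m (B' - B)) i j + ((A' - A) *m B) i j.
  by rewrite !mulmx2 !mxE; ring.
have hA' i' j' : inO (- e%:Z) (A' i' j').
  rewrite -[A' _ _](subrK (A i' j')); apply: inOD; last exact: he.
  by apply: inO_le (hA _ _); lia.
rewrite !mulmx2 !mxE; do 2 apply: inOD.
- by apply: inOM_le (hA' _ _) (hB _ _) _; lia.
- by apply: inOM_le (hA' _ _) (hB _ _) _; lia.
- by apply: inOM_le (hA _ _) (hf f _ _ _) _ => //; lia.
- by apply: inOM_le (hA _ _) (hf f _ _ _) _ => //; lia.
Qed.

Lemma congM (x y : S) (n : nat) : exists m : nat, forall k : nat, (m <= k)%N ->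
  forall x' y' : S, cong k x' x -> cong k y' y -> cong n (x' * y')%g (x * y)%g.
Proof.
by have [m mP] := cong_mulmx x y n; exists m => k mk x' y'; exact: mP.
Qed.

Lemma congV n (x y : S) : cong n x y -> cong n x^-1%g y^-1%g.
Proof.
move=> xy.
suff adj (x' y' : S) :
    [/\ x' 0 0 = x 1 1, x' 0 1 = - x 0 1, x' 1 0 = - x 1 0 & x' 1 1 = x 0 0] ->
    [/\ y' 0 0 = y 1 1, y' 0 1 = - y 0 1, y' 1 0 = - y 1 0 & y' 1 1 = y 0 0] ->
  cong n x' y' by apply: adj; exact: SL2V.
move=> [x0 x1 x2 x3] [y0 y1 y2 y3] i j.
case: (ord2P i) => ->; case: (ord2P j) => ->.
- by rewrite x0 y0; exact: xy.
- by rewrite x1 y1 -opprD; apply/inON/xy.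
- by rewrite x2 y2 -opprD; apply/inON/xy.
- by rewrite x3 y3; exact: xy.
Qed.

Lemma congJ (x y : S) (n : nat) : exists m : nat, forall k : nat, (m <= k)%N ->
  forall x' y' : S, cong k x' x -> cong k y' y -> cong n (x' ^ y')%g (x ^ y)%g.
Proof.
have [m1 h1] := congM y^-1%g (x * y)%g n; have [m2 h2] := congM x y m1.
exists (m1 + m2)%N => k hk x' y' hx hy; apply: h1 (leqnn _) _ _ _ _.
  by apply: congV; apply: cong_le hy; lia.
by apply: h2 hx hy; lia.
Qed.

Lemma congR (x y : S) (n : nat) : exists m : nat, forall k : nat, (m <= k)%N ->
  forall x' y' : S, cong k x' x -> cong k y' y -> cong n [~ x', y']%g [~ x, y]%g.
Proof.
have [m1 h1] := congM x^-1%g (x ^ y)%g n; have [m2 h2] := congJ x y m1.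
exists (m1 + m2)%N => k hk x' y' hx hy; apply: h1 (leqnn _) _ _ _ _.
  by apply: congV; apply: cong_le hx; lia.
by apply: h2 hx hy; lia.
Qed.

Lemma inO_separated (x y : Qp) : x != y -> exists n : nat, forall x', inO n (x' - x) -> x' != y.
Proof.
rewrite -subr_eq0 => /hasval_ex[v vP]; exists `|(v + 1)%R|%N => x' hx.
apply/eqP => e; move: vP hx; rewrite {}e -opprB => vP /inON.
by move=> /(hasval_le vP); lia.
Qed.

End Congruence.

(** * Powers of matrices with diagonal close to 1 *)

Section Powers.
Context (p : nat) (hp : prime p).
Local Notation Qp := (padic hp).
Local Notation S := (SL 2 (padic hp)).
Local Notation inO := (@inO p hp).
Local Notation hasval := (@hasval p hp).
Local Notation pi := (p%:R : Qp).

(** Only the diagonal is controlled: the entry 0 1 is allowed to be huge, which is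
    the situation after conjugation by a large power of a hyperbolic element. *)
Definition diag_cong (n : int) (y : S) := inO n (y 0 0 - 1) /\ inO n (y 1 1 - 1).

(** The product of the two off-diagonal entries is small, since the determinant is 1.
    Hence taking powers acts on each off-diagonal entry almost as it does for a
    unipotent matrix, however large that entry is. *)
Lemma diag_congX (k : nat) (y : S) s : diag_cong k y ->
  [/\ diag_cong k (y ^+ s)%g,
   exists2 z, inO k z & (y ^+ s)%g 0 1 = (s%:R + z) * y 0 1 &
   exists2 z, inO k z & (y ^+ s)%g 1 0 = (s%:R + z) * y 1 0].
Proof.
move=> [ya yd].
have int_cong (a : Qp) : inO k (a - 1) -> inO 0 a.
  by move=> ha; rewrite -[a](subrK 1); apply: inOD (inO1 hp); apply: inO_le ha.
have ya0 := int_cong _ ya; have yd0 := int_cong _ yd.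
have dy := SL2_det y.
have bc : inO k (y 0 1 * y 1 0).
  have -> : y 0 1 * y 1 0 = (y 0 0 - 1) * y 1 1 + (y 1 1 - 1).
    rewrite (_ : y 0 1 * y 1 0 = y 0 0 * y 1 1 - 1); last by rewrite -dy; ring.
    by ring.
  by apply: inOD => //; apply: inOM_le ya yd0 _; lia.
elim: s => [|s [[IHa IHd] [z hz IHb] [w hw IHc]]].
  rewrite expg0 !SL2_1 /= ; split; first by split; rewrite SL2_1 subrr; exact: inO0.
    by exists 0; [exact: inO0|rewrite !add0r mul0r].
  by exists 0; [exact: inO0|rewrite !add0r mul0r].
have hs (u : Qp) : inO k u -> inO 0 (s%:R + u).
  by move=> hu; apply: inOD; [exact: inO_natr|apply: inO_le hu].
rewrite expgSr !SL2M IHb IHc; split.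
- split; rewrite !SL2M ?IHb ?IHc.
  + have -> : (y ^+ s)%g 0 0 * y 0 0 + (s%:R + z) * y 0 1 * y 1 0 - 1 =
      ((y ^+ s)%g 0 0 - 1) * y 0 0 + (y 0 0 - 1) + (s%:R + z) * (y 0 1 * y 1 0) by ring.
    apply: inOD; last by apply: inOM_le (hs _ hz) bc _; lia.
    by apply: inOD => //; apply: inOM_le IHa ya0 _; lia.
  + have -> : (s%:R + w) * y 1 0 * y 0 1 + (y ^+ s)%g 1 1 * y 1 1 - 1 =
      ((y ^+ s)%g 1 1 - 1) * y 1 1 + (y 1 1 - 1) + (s%:R + w) * (y 0 1 * y 1 0) by ring.
    apply: inOD; last by apply: inOM_le (hs _ hw) bc _; lia.
    by apply: inOD => //; apply: inOM_le IHd yd0 _; lia.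
- exists (((y ^+ s)%g 0 0 - 1) + z + (s%:R + z) * (y 1 1 - 1)).
    apply: inOD; first exact: inOD.
    by apply: inOM_le (hs _ hz) yd _; lia.
  by rewrite -natr1; ring.
- exists (((y ^+ s)%g 1 1 - 1) + w + (s%:R + w) * (y 0 0 - 1)).
    apply: inOD; first exact: inOD.
    by apply: inOM_le (hs _ hw) ya _; lia.
  by rewrite -natr1; ring.
Qed.

Lemma hasval_piD (z : Qp) : inO 2 z -> hasval 1 (pi + z).
Proof.
by move=> hz; apply: hasvalD => //; rewrite -[pi]expr1z; apply: hasval_piz.
Qed.

(** Each p-th power adds exactly 1 to the valuation of the entry 0 1; taking p-th
    powers one at a time avoids the loss of precision that a direct use of
    [diag_congX] with s = p ^ j would cause. *)
Lemma hasval_upper_entry_expp (k j : nat) (y : S) w : (2 <= k)%N -> diag_cong k y ->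
  hasval w (y 0 1) -> hasval (w + j%:Z) ((y ^+ (p ^ j))%g 0 1).
Proof.
move=> k2 yk yw; elim: j => [|j IH]; first by rewrite expn0 expg1 addr0.
have [yj _ _] := diag_congX (p ^ j) yk.
rewrite expnSr expgnA; have [_ [z hz ->] _] := diag_congX p yj.
have -> : w + j.+1%:Z = 1 + (w + j%:Z) by lia.
by apply: hasvalM IH; apply: hasval_piD; apply: inO_le hz; lia.
Qed.

(** A form of torsion-freeness of the congruence subgroups, with the same two cases
    for the exponent, a p-adic unit or a multiple of p. *)
Lemma expg10_neq0 (k n : nat) (y : S) : (2 <= k)%N -> diag_cong k y ->
  y 1 0 != 0 -> (0 < n)%N -> (y ^+ n)%g 1 0 != 0.
Proof.
move=> k2; elim/ltn_ind: n y => n IH y yk y10 n0.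
have [/dvdnP[m mE]|pn] := boolP (p %| n)%N; last first.
  have [_ _ [z hz ->]] := diag_congX n yk; rewrite mulf_neq0//.
  apply: (@hasval_neq0 _ _ 0); apply: hasvalD; first exact: hasval_natr.
  by apply: inO_le hz; lia.
have [yp _ [z hz yE]] := diag_congX p yk.
rewrite mE mulnC expgnA; apply: IH => //.
- by rewrite mE ltn_Pmulr ?prime_gt1//; case: (m) mE n0 => // ->.
- rewrite yE mulf_neq0//; apply: (@hasval_neq0 _ _ 1).
  by apply: hasval_piD; apply: inO_le hz; lia.
- by case: (m) mE n0 => // ->.
Qed.

End Powers.

(** * Recurrence of a diagonal element forces density *)

Section Dynamics.
Context (p : nat) (hp : prime p).
Local Notation Qp := (padic hp).
Local Notation S := (SL 2 (padic hp)).
Local Notation inO := (@inO p hp).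
Local Notation hasval := (@hasval p hp).
Local Notation pi := (p%:R : Qp).

Definition dense_cong (L : set S) :=
  forall (A : S) (n : nat), exists2 x, L x & cong n x A.

(** The lower Vietoris condition for singletons, which passes to projections and to
    conjugates. *)
Definition recurrent (L D : set S) := forall g x (N : nat), L g -> D x ->
  exists2 n : nat, (N < n)%N & D (x ^ (g ^+ n))%g.

Definition is_subgroup (D : set S) :=
  [/\ D 1%g, forall x y, D x -> D y -> D (x * y)%g & forall x, D x -> D x^-1%g].

(** If the commutator x of h and G has x 0 1 = 0, then the second columns of h G
    and G h are proportional. The left side is the determinant of these columns,
    for h = (a b; c d) and G = (A B; C E). When G is close to a lower triangular
    unipotent matrix, r1 and r2 are small and b ^ 2 dominates. *)
Lemma commutator_det_expansion (a b c d A B C E r1 r2 : Qp) : B = r1 * C -> A = E + r2 * C ->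
  (a * B + b * E) * (C * b + E * d) - (c * B + d * E) * (A * b + B * d) =
  C * (E * (b * b) + (r1 * (a * (C * b + E * d) - c * (E * b + r2 * C * b + r1 * C * d)
         - d * d * E) - r2 * (b * d * E))).
Proof. by move=> -> ->; ring. Qed.

(** To be applied to powers G of g. As G commutes with g, the ratios r1 = g 0 1 / g 1 0
    and r2 = (g 0 0 - g 1 1) / g 1 0 are those of G as well, so that the estimate is
    uniform in the exponent, on which there is no control. *)
Lemma commutator_upper_entry_neq0 (h g G x : S) (e K : nat) (v : int) :
  (forall i j, inO (- e%:Z) (h i j)) -> hasval v (h 0 1) ->
  (2 * v < K%:Z - 2 * e%:Z) ->
  (h * G = G * h * x)%g -> (g * G = G * g)%g -> g 1 0 != 0 ->
  inO K (g 0 1 / g 1 0) -> inO K ((g 0 0 - g 1 1) / g 1 0) ->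
  inO 1 (G 1 1 - 1) -> inO 0 (G 1 0) -> G 1 0 != 0 -> x 0 1 != 0.
Proof.
move=> he hv vK hG gG g10 r1O r2O E1 C0 C_neq0; apply/eqP => x01.
have hG01 := congr1 (fun y : S => y 0 1) hG.
have hG11 := congr1 (fun y : S => y 1 1) hG.
have gG00 := congr1 (fun y : S => y 0 0) gG.
have gG10 := congr1 (fun y : S => y 1 0) gG.
move: hG01 hG11 gG00 gG10; rewrite !SL2M x01 !mulr0 !add0r => hG01 hG11 gG00 gG10.
set r1 := _ / _ in r1O; set r2 := _ / _ in r2O.
have BE : G 0 1 = r1 * G 1 0.
  apply: (mulIf g10); rewrite mulrAC /r1 divfK//.
  by apply: (addrI (G 0 0 * g 0 0)); rewrite -gG00; ring.
have AE : G 0 0 = G 1 1 + r2 * G 1 0.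
  apply: (mulfI g10); rewrite mulrDr mulrA [g 1 0 * r2]mulrC /r2 divfK//.
  by apply: (addIr (g 1 1 * G 1 0)); rewrite gG10; ring.
have := commutator_det_expansion (h 0 0) (h 0 1) (h 1 0) (h 1 1) BE AE.
rewrite hG01 hG11 => /esym; rewrite [RHS](_ : _ = 0); last by ring.
have E0 : inO 0 (G 1 1).
  by rewrite -[G 1 1](subrK 1); apply: inOD (inO1 hp); apply: inO_le E1.
have r10 : inO 0 r1 by apply: inO_le r1O; lia.
have r20 : inO 0 r2 by apply: inO_le r2O; lia.
have hh i j i' j' : inO (- (2 * e%:Z)) (h i j * h i' j').
  by apply: inOM_le (he _ _) (he _ _) _; lia.
have O0M n y z : inO 0 y -> inO n z -> inO n (y * z).
  by move=> hy hz; apply: inOM_le hy hz _; lia.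
have EV : hasval (2 * v) (G 1 1 * (h 0 1 * h 0 1)).
  have -> : 2 * v = 0 + (v + v) by lia.
  apply: hasvalM; last exact: hasvalM.
  by rewrite -[G 1 1](subrK 1) addrC; apply: hasval1D.
apply/eqP; apply: mulf_neq0 => //; apply: (@hasval_neq0 _ _ (2 * v)).
apply: hasvalD => //; apply: (@inO_le _ _ _ (K%:Z - 2 * e%:Z)); first by lia.
apply: inOB.
  apply: inOM; first exact: r1O.
  have -> : h 0 0 * (G 1 0 * h 0 1 + G 1 1 * h 1 1)
    - h 1 0 * (G 1 1 * h 0 1 + r2 * G 1 0 * h 0 1 + r1 * G 1 0 * h 1 1)
    - h 1 1 * h 1 1 * G 1 1 =
    G 1 0 * (h 0 0 * h 0 1) + G 1 1 * (h 0 0 * h 1 1) - G 1 1 * (h 1 0 * h 0 1)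
    - r2 * (G 1 0 * (h 1 0 * h 0 1)) - r1 * (G 1 0 * (h 1 0 * h 1 1))
    - G 1 1 * (h 1 1 * h 1 1) by ring.
  by repeat first [exact: hh | exact: E0 | exact: C0 | exact: r10 | exact: r20
    | apply: inOB | apply: inOD | apply: (O0M)].
apply: inOM; first exact: r2O.
have -> : h 0 1 * h 1 1 * G 1 1 = G 1 1 * (h 0 1 * h 1 1) by ring.
by apply: (O0M) => //; exact: hh.
Qed.

(** D is not discrete: if g in L is close to 1 and g ^- n h g ^ n lies in D, then so
    does the commutator of h and g ^ n, which is close to 1. Choosing g close to
    a lower unipotent matrix makes the entry 0 1 of the commutator nonzero for
    every n >= 1. *)
Lemma exists_small_with_upper_entry (L D : set S) (h : S) (k : nat) :
  dense_cong L -> is_subgroup D -> recurrent L D -> D h -> h 0 1 != 0 ->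
  exists x : S, [/\ D x, cong k x (1%g : S) & x 0 1 != 0].
Proof.
move=> Ldense [D1 DM DV] rec Dh h01.
have [v hv] := hasval_ex h01; have [e he] := bounded_mx h.
have [m hm] := congR h 1%g k.
(* Modulo p ^ K the commutator is 1 to the required precision. The excess K' of
   M over K bounds the two ratios and must beat the valuation of h 0 1 ^ 2. *)
pose K := (m + 2)%N; pose K' := (`|(2 * v)%R| + 2 * e + 1)%N; pose M := (K + K')%N.
have [|A [A00 A01 A10 A11]] := @SL2_ex _ (1 : Qp) 0 (pi ^ K%:Z) 1.
  by rewrite mulr1 mul0r subr0.
have [g Lg gA] := Ldense A M.
have g00 : inO M (g 0 0 - 1) by rewrite -A00; exact: gA.
have g11 : inO M (g 1 1 - 1) by rewrite -A11; exact: gA.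
have g01 : inO M (g 0 1) by rewrite -[g 0 1]subr0 -A01; exact: gA.
have g10 : hasval K%:Z (g 1 0).
  rewrite -[g 1 0](subrK (A 1 0)) addrC; apply: hasvalD.
    by rewrite A10; exact: hasval_piz.
  by apply: inO_le (gA _ _); lia.
have [n n0 Dn] := rec g h 0%N Lg Dh.
have [[G00 G11] [z zO G01] [w wO G10]] :
    [/\ diag_cong M (g ^+ n)%g,
   exists2 z, inO M z & (g ^+ n)%g 0 1 = (n%:R + z) * g 0 1 &
   exists2 z, inO M z & (g ^+ n)%g 1 0 = (n%:R + z) * g 1 0].
  by apply: diag_congX.
have hn (u : Qp) : inO M u -> inO 0 (n%:R + u).
  by move=> hu; apply: inOD; [exact: inO_natr|apply: inO_le hu].
have G10_neq0 : (g ^+ n)%g 1 0 != 0.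
  by apply: (@expg10_neq0 _ _ M) => //; [lia|exact: hasval_neq0 g10].
have Gcomm : (g * g ^+ n = g ^+ n * g)%g by rewrite -expgS expgSr.
have : D [~ h, (g ^+ n)]%g by apply: DM => //; exact: DV.
have := commgC h (g ^+ n)%g.
have cong1 : cong K (g ^+ n)%g (1%g : S).
  have K_le : (K%:Z <= M%:Z) by lia.
  move=> i j; case: (ord2P i) => ->; case: (ord2P j) => ->; rewrite SL2_1 /=.
  - exact: inO_le G00.
  - by rewrite subr0 G01; apply: inOM_le (hn _ zO) g01 _; lia.
  - by rewrite subr0 G10; apply: inOM_le (hn _ wO) (hasval_in g10) _; lia.
  - exact: inO_le G11.
have : cong k [~ h, (g ^+ n)]%g [~ h, 1]%g.
  apply: (hm K) => //; [lia|exact: cong_refl].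
rewrite commg1.
move: {G00 Dn hm cong1} (g ^+ n)%g [~ h, (g ^+ n)]%g G11 G01 G10 G10_neq0 Gcomm
  => G x G11 G01 G10 G10_neq0 Gcomm nx hG Dx.
exists x; split=> //.
apply: (@commutator_upper_entry_neq0 h g G x e K' v) => //.
- exact: he.
- by rewrite /K'; lia.
- exact: hasval_neq0 g10.
- have [_ _ gV] := g10; apply: inOM_le g01 gV _; lia.
- have [_ _ gV] := g10.
  have g0011 : inO M (g 0 0 - g 1 1).
    have -> : g 0 0 - g 1 1 = (g 0 0 - 1) - (g 1 1 - 1) by ring.
    exact: inOB.
  apply: inOM_le g0011 gV _; lia.
- by apply: inO_le G11; lia.
- by rewrite G10; apply: inOM_le (hn _ wO) (hasval_in g10) _; lia.
Qed.

Lemma diagX (g : S) l m : l != 0 -> g 0 0 = l -> g 0 1 = 0 -> g 1 0 = 0 ->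
  g 1 1 = l^-1 ->
  [/\ (g ^+ m)%g 0 0 = l ^+ m, (g ^+ m)%g 0 1 = 0, (g ^+ m)%g 1 0 = 0 &
      (g ^+ m)%g 1 1 = (l ^+ m)^-1].
Proof.
move=> l0 g00 g01 g10 g11; elim: m => [|m [h00 h01 h10 h11]].
  by rewrite expg0 !SL2_1 expr0 invr1.
rewrite expgSr !SL2M g00 g01 g10 g11 h00 h01 h10 h11 !(mulr0, mul0r, addr0, add0r).
by split=> //; rewrite ?exprSr// invfM mulrC.
Qed.

Lemma conj_diag (x y G : S) l : l != 0 -> (G * y = x * G)%g ->
  G 0 0 = l -> G 0 1 = 0 -> G 1 0 = 0 -> G 1 1 = l^-1 ->
  [/\ y 0 0 = x 0 0, y 0 1 = x 0 1 / l ^+ 2, y 1 0 = x 1 0 * l ^+ 2 & y 1 1 = x 1 1].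
Proof.
move=> l0 e G00 G01 G10 G11.
have e00 := congr1 (fun y : S => y 0 0) e.
have e01 := congr1 (fun y : S => y 0 1) e.
have e10 := congr1 (fun y : S => y 1 0) e.
have e11 := congr1 (fun y : S => y 1 1) e.
move: e00 e01 e10 e11; rewrite !SL2M G00 G01 G10 G11 !(mulr0, mul0r, addr0, add0r).
have lV0 : l^-1 != 0 by rewrite invr_eq0.
move=> e00 e01 e10 e11; split.
- by apply: (mulfI l0); rewrite e00 mulrC.
- by apply: (mulfI l0); rewrite e01 expr2 invfM mulrCA mulVKf.
- by apply: (mulfI lV0); rewrite e10 expr2 mulrCA mulKf.
- by apply: (mulfI lV0); rewrite e11 mulrC.
Qed.

Lemma hasvalX v (x : Qp) m : hasval v x -> hasval (m%:Z * v) (x ^+ m).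
Proof.
move=> hx; elim: m => [|m IH].
  rewrite mul0r expr0 -[1]addr0; apply: hasval1D; exact: inO0.
rewrite exprS (_ : _ * v = v + m%:Z * v); last by rewrite intS mulrDl mul1r.
exact: hasvalM.
Qed.

(** A small x with x 0 1 != 0 becomes, after conjugation by a large power of
    g = diag(l, 1/l), a matrix y0 with diagonal close to 1, entry 1 0 close to 0 and
    entry 0 1 as large as desired. A suitable power of y0 brings the entry 0 1 to
    beta while the others stay close to those of the identity. *)
Lemma upper_unipotent (L D : set S) (g u : S) (l beta : Qp) (s : int) (n : nat) :
  is_subgroup D -> recurrent L D -> L g ->
  hasval s l -> 1 <= s ->
  g 0 0 = l -> g 0 1 = 0 -> g 1 0 = 0 -> g 1 1 = l^-1 ->
  (forall k : nat, exists x : S, [/\ D x, cong k x (1%g : S) & x 0 1 != 0]) ->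
  u 0 0 = 1 -> u 0 1 = beta -> u 1 0 = 0 -> u 1 1 = 1 ->
  exists2 y, D y & cong n y u.
Proof.
move=> [D1 DM DV] rec Lg ls s1 g00 g01 g10 g11 small u00 u01 u10 u11.
have DX (x : S) m : D x -> D (x ^+ m)%g.
  by move=> Dx; elim: m => [|m IH]; [rewrite expg0|rewrite expgS; apply: DM].
have [beta0|/hasval_ex[r betar]] := eqVneq beta 0.
  exists 1%g => //; have -> : u = 1%g; last exact: cong_refl.
  by apply: SL2_eq; rewrite SL2_1 ?u00 ?u01 ?u10 ?u11.
(* The errors are O(p ^ k) on the diagonal and O(p ^ (k + r)) on the entry 0 1. *)
pose k := (2 + n + `|n%:Z - r|)%N.
have [x [Dx xk x01]] := small k.
have [v vx] := hasval_ex x01.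
have [m mr Dy0] := rec g x `|v - r|%N Lg Dx.
have l0 := hasval_neq0 ls.
have [G00 G01 G10 G11] := diagX m l0 g00 g01 g10 g11.
have conjE : (g ^+ m * x ^ (g ^+ m) = x * g ^+ m)%g by rewrite -conjgC.
have lm0 : l ^+ m != 0 by rewrite expf_neq0.
have [y00 y01 y10 y11] := conj_diag lm0 conjE G00 G01 G10 G11.
move: (x ^ (g ^+ m))%g Dy0 y00 y01 y10 y11 {conjE} => y0 Dy0 y00 y01 y10 y11.
have l2 : hasval (m%:Z * s * 2) ((l ^+ m) ^+ 2).
  by rewrite mulrC; apply: hasvalX; apply: hasvalX.
have y0k : diag_cong k y0.
  split; [rewrite y00|rewrite y11].
    by have := xk 0 0; rewrite SL2_1.
  by have := xk 1 1; rewrite SL2_1.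
have y01v : hasval (v - m%:Z * s * 2) (y0 0 1).
  by rewrite y01; apply: hasvalM => //; apply: hasvalV.
have ms : m%:Z <= m%:Z * s by nia.
have y10k : inO k (y0 1 0).
  rewrite y10; have := xk 1 0; rewrite SL2_1 subr0 => x10.
  by apply: inOM_le x10 (hasval_in l2) _; lia.
(* The p ^ j-th power of y0 has an entry 0 1 of the valuation r of beta, so that a
   p-adic unit is left, which is approximated by a natural number t. *)
pose j := `|(r - (v - m%:Z * s * 2))%R|%N.
have y1v : hasval r ((y0 ^+ (p ^ j))%g 0 1).
  have -> : r = v - m%:Z * s * 2 + j%:Z by rewrite /j; lia.
  by apply: (@hasval_upper_entry_expp _ _ k) => //; lia.
have [y1k _ [z1 z1O y1_10]] := diag_congX (p ^ j) y0k.
have {}y1_10 : inO k ((y0 ^+ (p ^ j))%g 1 0).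
  rewrite y1_10 mulrDl; apply: inOD; first by apply: inOM_le (inO_natr hp _) y10k _; lia.
  by apply: inOM_le z1O y10k _; lia.
have Dy1 := DX y0 (p ^ j)%N Dy0.
move: (y0 ^+ (p ^ j))%g Dy1 y1v y1k y1_10 => y1 Dy1 y1v y1k y1_10.
have y1_01 := hasval_neq0 y1v.
have [|t ht] := @inO_natr_approx _ hp (beta / y1 0 1) k.
  rewrite -(subrr r); apply: inOM; first exact: hasval_in betar.
  by case: y1v.
exists (y1 ^+ t)%g; first exact: DX.
have [[ty00 ty11] [z zO ty01] [w wO ty10]] := diag_congX t y1k.
have kn : n%:Z <= k%:Z by lia.
move=> i' j'; case: (ord2P i') => ->; case: (ord2P j') => ->.
- by rewrite u00; exact: inO_le ty00.
- rewrite ty01 u01.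
  have -> : (t%:R + z) * y1 0 1 - beta = (z - (beta / y1 0 1 - t%:R)) * y1 0 1.
    by rewrite [RHS]mulrBl (mulrBl _ (beta / _)) divfK//; ring.
  apply: inOM_le (inOB zO ht) (hasval_in y1v) _; lia.
- rewrite u10 subr0 ty10 mulrDl; apply: inOD.
    by apply: inOM_le (inO_natr hp _) y1_10 _; lia.
  by apply: inOM_le wO y1_10 _; lia.
- by rewrite u11; exact: inO_le ty11.
Qed.

Definition cong_closure (D : set S) : set S :=
  [set x | forall n : nat, exists2 y, D y & cong n y x].

Lemma cong_closureM (D : set S) x y : is_subgroup D ->
  cong_closure D x -> cong_closure D y -> cong_closure D (x * y)%g.
Proof.
move=> [_ DM _] Dx Dy n; have [m mP] := congM x y n.
have [x' Dx' xx'] := Dx m; have [y' Dy' yy'] := Dy m.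
by exists (x' * y')%g; [exact: DM|exact: (mP m)].
Qed.

(** A matrix A with A 1 0 != 0 has the form v1 h u h v2 with u, v1, v2 upper
    unipotent: u is chosen to give A 1 0, then v1 and v2 adjust the diagonal, and the
    last entry is forced by the determinant. If A 1 0 = 0 the same applies to A h. *)
Lemma upper_unipotents_generate (H : set S) (h : S) :
  (forall x y, H x -> H y -> H (x * y)%g) -> H h -> H h^-1%g ->
  (forall u : S, u 0 0 = 1 -> u 1 0 = 0 -> u 1 1 = 1 -> H u) -> h 1 0 != 0 ->
  forall A, H A.
Proof.
move=> HM Hh HhV Hu h10.
have uex (t : Qp) : exists u : S, [/\ H u, u 0 0 = 1, u 0 1 = t, u 1 0 = 0 & u 1 1 = 1].
  have [|u [u00 u01 u10 u11]] := @SL2_ex _ (1 : Qp) t 0 1; first by ring.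
  by exists u; split => //; exact: (Hu).
have low (A : S) : A 1 0 != 0 -> H A.
  move=> A10.
  pose c := h 1 0; pose s := (A 1 0 / c - h 0 0 - h 1 1) / c.
  have [us [Hus us00 us01 us10 us11]] := uex s.
  have [B [HB B10]] : exists B : S, H B /\ B 1 0 = A 1 0.
    exists (h * us * h)%g; split; first by do 2 apply: (HM) => //.
    rewrite !SL2M us00 us01 us10 us11 /s /c.
    by rewrite mulr1 mulr0 addr0 mulr1 mulrCA mulfV// mulr1 !subrK mulrBl divfK//; ring.
  have [v1 [Hv1 v100 v101 v110 v111]] := uex ((A 0 0 - B 0 0) / A 1 0).
  have [v2 [Hv2 v200 v201 v210 v211]] := uex ((A 1 1 - B 1 1) / A 1 0).
  have -> : A = (v1 * B * v2)%g; last by do 2 apply: (HM) => //.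
  have e00 : A 0 0 = (v1 * B * v2)%g 0 0.
    rewrite !SL2M v100 v101 v200 v210 B10.
    by rewrite mulr0 addr0 mulr1 mul1r divfK//; ring.
  have e10 : A 1 0 = (v1 * B * v2)%g 1 0.
    by rewrite !SL2M v110 v111 v200 v210 B10; ring.
  have e11 : A 1 1 = (v1 * B * v2)%g 1 1.
    rewrite !SL2M v110 v111 v201 v211 B10.
    by rewrite mulr1 mul0r mul1r add0r mul0r mul1r add0r mulrC divfK//; ring.
  apply: SL2_eq => //; apply: (mulIf A10).
  have d1 := SL2_det A; have d2 := SL2_det (v1 * B * v2)%g.
  rewrite -e00 -e10 -e11 -{1}d1 in d2.
  by apply: oppr_inj; apply: (addrI (A 0 0 * A 1 1)); rewrite d2.
move=> A; have [A10|/low//] := eqVneq (A 1 0) 0.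
have A11 : A 1 1 != 0.
  apply/eqP => A11; have := SL2_det A; rewrite A10 A11 !mulr0 subr0 => /esym/eqP.
  by rewrite oner_eq0.
rewrite -(mulgK h A); apply: HM => //; apply: low.
by rewrite SL2M A10 mul0r add0r mulf_neq0.
Qed.

Lemma dense_of_diag (L D : set S) (g h : S) (l : Qp) :
  dense_cong L -> is_subgroup D -> recurrent L D -> L g -> D h ->
  l != 0 -> inO 1 l ->
  g 0 0 = l -> g 0 1 = 0 -> g 1 0 = 0 -> g 1 1 = l^-1 ->
  h 0 1 != 0 -> h 1 0 != 0 -> dense_cong D.
Proof.
move=> Ldense Dgr rec Lg Dh l0 lO g00 g01 g10 g11 h01 h10.
have [s ls] := hasval_ex l0.
have s1 : 1 <= s by exact: hasval_le ls lO.
have Dcl x : D x -> cong_closure D x by move=> Dx n; exists x => //; exact: cong_refl.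
apply: (@upper_unipotents_generate (cong_closure D) h) => //.
- by move=> x y; exact: cong_closureM.
- exact: Dcl.
- by apply: Dcl; case: Dgr => _ _; apply.
move=> u u00 u10 u11 n.
apply: (@upper_unipotent L D g u l (u 0 1) s n) => //.
by move=> k; exact: exists_small_with_upper_entry Ldense Dgr rec Dh h01.
Qed.

End Dynamics.

(** * Reduction to a diagonal element *)

Section TraceIdentities.
Context (K : comUnitRingType).
Implicit Types x h g P : SL 2 K.

Lemma SL2_trJ x P : (x ^ P)%g 0 0 + (x ^ P)%g 1 1 = x 0 0 + x 1 1.
Proof.
rewrite conjgE; have := SL2V P; move: (P^-1)%g => P' [P00 P01 P10 P11].
rewrite !SL2M P00 P01 P10 P11 -[RHS]mulr1 -(SL2_det P); ring.
Qed.

(** Companion matrices have the lower left entry 1, which makes [diagonalize]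
    applicable, and an arbitrary trace t. *)
Lemma commg_trace_companion h g t :
  g 0 0 = t -> g 0 1 = -1 -> g 1 0 = 1 -> g 1 1 = 0 ->
  [~ h, g]%g 0 0 + [~ h, g]%g 1 1 = 2%:R - (h 0 1 * h 1 0) * t ^+ 2 +
    (h 0 0 - h 1 1) * (h 0 1 - h 1 0) * t + ((h 0 0 - h 1 1) ^+ 2 + (h 0 1 + h 1 0) ^+ 2).
Proof.
move=> g00 g01 g10 g11; rewrite commgEl conjgE.
have := SL2V h; have := SL2V g; rewrite g00 g01 g10 g11.
move: (g^-1)%g (h^-1)%g => g' h' [g'00 g'01 g'10 g'11] [h00 h01 h10 h11].
rewrite !SL2M g00 g01 g10 g11 g'00 g'01 g'10 g'11 h00 h01 h10 h11.
have -> : 2%:R = (h 0 0 * h 1 1 - h 0 1 * h 1 0) *+ 2 by rewrite (SL2_det h).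
by ring.
Qed.

(** A commutator with a hyperbolic element of eigenvalues l and m has trace 2 exactly
    when h fixes one of the two eigenlines. Being invariant under conjugation, this
    expresses the generic position of h and g before diagonalising g. *)
Lemma commg_trace_diag h g l m : l * m = 1 ->
  g 0 0 = l -> g 0 1 = 0 -> g 1 0 = 0 -> g 1 1 = m ->
  [~ h, g]%g 0 0 + [~ h, g]%g 1 1 = 2%:R - h 0 1 * h 1 0 * (l - m) ^+ 2.
Proof.
move=> lm g00 g01 g10 g11; rewrite commgEl conjgE.
have := SL2V h; have := SL2V g; rewrite g00 g01 g10 g11.
move: (g^-1)%g (h^-1)%g => g' h' [g'00 g'01 g'10 g'11] [h00 h01 h10 h11].
rewrite !SL2M g00 g01 g10 g11 g'00 g'01 g'10 g'11 h00 h01 h10 h11.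
have -> : 2%:R = (h 0 0 * h 1 1 - h 0 1 * h 1 0) * (l * m) *+ 2.
  by rewrite (SL2_det h) lm mulr1.
by ring.
Qed.

End TraceIdentities.

(** A polynomial of degree 2 that vanishes at T, - T and T ^ 2 is zero, and its
    coefficients vanish together only if the matrix (a b; c d) is scalar. It is the
    trace of [commg_trace_companion] minus 2. *)
Lemma quadratic_nonvanishing (F : fieldType) (T a b c d : F) :
  T != 0 -> T ^+ 2 != 1 -> 2%:R != 0 :> F -> ~ [/\ b = 0, c = 0 & a = d] ->
  exists2 t, t = T \/ t = - T \/ t = T ^+ 2 &
    - (b * c) * t ^+ 2 + (a - d) * (b - c) * t + ((a - d) ^+ 2 + (b + c) ^+ 2) != 0.
Proof.
move=> T0 T1 two0 nscal; apply: contrapT => noT; apply: nscal.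
set Q := fun t => - (b * c) * t ^+ 2 + (a - d) * (b - c) * t + ((a - d) ^+ 2 + (b + c) ^+ 2).
have Q0 t : t = T \/ t = - T \/ t = T ^+ 2 -> Q t = 0.
  by move=> ht; apply/eqP/negPn/negP => Qt; apply: noT; exists t.
have Q1 := Q0 T (or_introl erefl).
have Q2 := Q0 (- T) (or_intror (or_introl erefl)).
have Q3 := Q0 (T ^+ 2) (or_intror (or_intror erefl)).
have w0 : (a - d) * (b - c) = 0.
  have : 2%:R * T * ((a - d) * (b - c)) = Q T - Q (- T) by rewrite /Q; ring.
  by rewrite Q1 Q2 subrr => /eqP; rewrite !mulf_eq0 (negPf two0) (negPf T0) /= -mulf_eq0 => /eqP.
have u0 : b * c = 0.
  have : T ^+ 2 * (T ^+ 2 - 1) * (b * c) = (a - d) * (b - c) * (T ^+ 2 - T) + Q T - Q (T ^+ 2).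
    by rewrite /Q; ring.
  rewrite w0 Q1 Q3 mul0r addr0 subrr => /eqP.
  by rewrite mulf_eq0 mulf_eq0 expf_eq0 /= (negPf T0) subr_eq0 (negPf T1) => /eqP.
have k0 : (a - d) ^+ 2 + (b + c) ^+ 2 = 0.
  by move: Q1; rewrite /Q w0 u0 oppr0 !mul0r !add0r.
move/eqP: w0; rewrite mulf_eq0 !subr_eq0 => /orP[]/eqP e.
  move: k0; rewrite e subrr expr0n add0r => /eqP; rewrite expf_eq0 /= addr_eq0 => /eqP be.
  move: u0; rewrite be mulNr => /eqP; rewrite oppr_eq0 mulf_eq0 orbb => /eqP ->.
  by rewrite oppr0.
move: u0; rewrite e => /eqP; rewrite mulf_eq0 orbb => /eqP c0.
move: k0; rewrite e c0 addr0 expr0n addr0 => /eqP; rewrite expf_eq0 /= subr_eq0 => /eqP.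
by split.
Qed.

Section Hyperbolic.
Context (p : nat) (hp : prime p).
Local Notation Qp := (padic hp).
Local Notation S := (SL 2 (padic hp)).
Local Notation inO := (@inO p hp).
Local Notation hasval := (@hasval p hp).
Local Notation pi := (p%:R : Qp).

(** The three requirements on g are open, so it is enough to meet them in SL_2, where
    companion matrices of large trace do, and to use the density of L. *)
Lemma exists_hyperbolic (L : set S) (h : S) : dense_cong L ->
  ~ [/\ h 0 1 = 0, h 1 0 = 0 & h 0 0 = h 1 1] ->
  exists g, [/\ L g, g 1 0 != 0, exists2 v, v <= -1 & hasval v (g 0 0 + g 1 1) &
    [~ h, g]%g 0 0 + [~ h, g]%g 1 1 != 2%:R].
Proof.
move=> Ldense nscal.
pose T : Qp := pi ^ (-1).
have TV : hasval (-1) T by exact: hasval_piz.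
have T2V : hasval (-2) (T ^+ 2) by rewrite (_ : -2 = 2%:Z * -1) //; apply: hasvalX.
have [|||t tE Qt] := @quadratic_nonvanishing _ T _ _ _ _ _ _ _ nscal.
- exact: hasval_neq0 TV.
- apply/eqP => T21; have := hasval_le T2V (_ : inO 0 (T ^+ 2)).
  by rewrite T21 => /(_ (inO1 hp)).
- exact: two_neq0.
have [v v1 tV] : exists2 v, v <= -1 & hasval v t.
  case: tE => [->|[->|->]]; [by exists (-1)| |by exists (-2)].
  exists (-1) => //; case: TV => T0 TO TVO; split; rewrite ?oppr_eq0// ?invrN; exact: inON.
have [|A [A00 A01 A10 A11]] := @SL2_ex _ t (-1) 1 0.
  by rewrite mulr0 mulr1 opprK add0r.
have trA : [~ h, A]%g 0 0 + [~ h, A]%g 1 1 != 2%:R.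
  rewrite (commg_trace_companion _ A00 A01 A10 A11) -subr_eq0.
  by move: Qt; congr (_ != 0); ring.
have [N hN] := inO_separated trA; have [m hm] := congR h A N.
have [g Lg gA] := Ldense A (m + 1)%N.
have g1 := cong_le (_ : 1 <= (m + 1)%N%:Z) gA.
exists g; split; first exact: Lg.
- apply: (@hasval_neq0 _ _ 0); rewrite -[g 1 0](subrK 1) addrC; apply: hasval1D.
  by have := g1 _ 1 0; rewrite A10; apply; lia.
- exists v => //.
  have -> : g 0 0 + g 1 1 = t + ((g 0 0 - A 0 0) + (g 1 1 - A 1 1)).
    by rewrite A00 A11; ring.
  by apply: hasvalD => //; apply: inO_le (inOD (gA _ _) (gA _ _)); lia.
- apply: hN.
  have hgA : cong N [~ h, g]%g [~ h, A]%g.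
    by apply: (hm (m + 1)%N) => //; [lia|exact: cong_refl].
  move: ([~ h, g]%g) ([~ h, A]%g) hgA => x y xy.
  have -> : x 0 0 + x 1 1 - (y 0 0 + y 1 1) = (x 0 0 - y 0 0) + (x 1 1 - y 1 1) by ring.
  exact: inOD.
Qed.

(** A trace of negative valuation makes the characteristic polynomial split, with
    eigenvalues l and l^-1 of different sizes. The columns of P are the eigenvectors
    (l - g 1 1, g 1 0) and (l^-1 - g 1 1, g 1 0), the first one scaled to give P
    determinant 1. *)
Lemma diagonalize (g : S) v : g 1 0 != 0 -> v <= -1 -> hasval v (g 0 0 + g 1 1) ->
  exists (l : Qp) (P : S), [/\ l != 0, inO 1 l &
    [/\ (g ^ P)%g 0 0 = l, (g ^ P)%g 0 1 = 0, (g ^ P)%g 1 0 = 0 & (g ^ P)%g 1 1 = l^-1]].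
Proof.
move=> c0 v1 tV; set tau := g 0 0 + g 1 1 in tV.
have tau0 := hasval_neq0 tV.
have [|l [lO lE]] := @hensel_reciprocal _ hp tau^-1.
  by case: tV => _ _; apply: inO_le; lia.
have l0 : l != 0.
  apply/eqP => l0; move: lE; rewrite l0 expr0n addr0 mulr1 => /esym/eqP.
  by rewrite invr_eq0 (negPf tau0).
have charl : tau * l = 1 + l * l by rewrite {1}lE mulVKf// expr2.
have mE : l^-1 = tau - l.
  by apply: (mulIf l0); rewrite mulVf// mulrBl charl addrK.
have lm : l - l^-1 != 0.
  rewrite subr_eq0; apply/eqP => lm; apply: (@one_notin1 _ hp).
  by rewrite -(mulfV l0) -lm; apply: (inO_le _ (inOM lO lO)).
pose w := (l - l^-1)^-1; have ww : w * (l - l^-1) = 1 by rewrite mulVf.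
pose cV := (g 1 0)^-1; have cc : cV * g 1 0 = 1 by rewrite mulVf.
have [|P [P00 P01 P10 P11]] := @SL2_ex _ ((l - g 1 1) * cV * w) (l^-1 - g 1 1) w (g 1 0).
  have -> : (l - g 1 1) * cV * w * g 1 0 - (l^-1 - g 1 1) * w =
    w * ((l - g 1 1) * (cV * g 1 0) - (l^-1 - g 1 1)) by ring.
  by rewrite cc mulr1 -[RHS]ww; ring.
have [|E [E00 E01 E10 E11]] := @SL2_ex _ l 0 0 l^-1.
  by rewrite mulfV// mulr0 subr0.
exists l, P; suff -> : (g ^ P)%g = E by [].
suff PE : (P * E = g * P)%g by rewrite conjgE -PE mulKg.
have dg := SL2_det g.
have bcE : g 0 1 * g 1 0 = g 0 0 * g 1 1 - 1 by rewrite -dg; ring.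
have bE : g 0 1 = (g 0 0 * g 1 1 - 1) * cV by rewrite -bcE -mulrA [_ * cV]mulrC cc mulr1.
have key1 : g 0 0 * (l - g 1 1) + (g 0 0 * g 1 1 - 1) = (l - g 1 1) * l.
  have -> : (l - g 1 1) * l = l * l + 1 - 1 - g 1 1 * l by ring.
  by rewrite [l * l + 1]addrC -charl /tau; ring.
have key2 : g 0 0 * (l^-1 - g 1 1) + (g 0 0 * g 1 1 - 1) = (l^-1 - g 1 1) * l^-1.
  have ml : l^-1 * l^-1 = tau * l^-1 - 1 by rewrite {1}mE mulrBl mulfV.
  by rewrite mulrBl ml /tau; ring.
apply: SL2_eq; rewrite !SL2M.
- rewrite P00 E00 P01 E10 P10 mulr0 addr0.
  have -> : (l - g 1 1) * cV * w * l = ((l - g 1 1) * l) * (cV * w) by ring.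
  by rewrite -key1 bE; ring.
- by rewrite P00 E01 P01 E11 P11 mulr0 add0r -key2 bcE.
- rewrite P10 E00 P11 E10 P00 mulr0 addr0.
  have -> : g 1 0 * ((l - g 1 1) * cV * w) = (cV * g 1 0) * ((l - g 1 1) * w) by ring.
  by rewrite cc mul1r; ring.
- by rewrite P10 E01 P11 E11 P01; ring.
Qed.

(** The hypotheses and the conclusion are invariant under conjugation, which reduces
    the statement to [dense_of_diag]. *)
Lemma dense_of_nonscalar (L D : set S) (h : S) : dense_cong L -> is_subgroup D ->
  recurrent L D -> D h -> ~ [/\ h 0 1 = 0, h 1 0 = 0 & h 0 0 = h 1 1] -> dense_cong D.
Proof.
move=> Ldense [D1 DM DV] rec Dh nscal.
have [g [Lg g10 [v v1 gV] trg]] := exists_hyperbolic Ldense nscal.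
have [l [P [l0 lO [E00 E01 E10 E11]]]] := diagonalize g10 v1 gV.
have transport (X : set S) : dense_cong X -> forall Q, dense_cong [set x | X (x ^ Q)%g].
  move=> Xd Q A n; have [m hm] := congJ (A ^ Q)%g Q^-1%g n.
  have [x Xx xA] := Xd (A ^ Q)%g m.
  exists (x ^ Q^-1)%g; first by rewrite /= conjgKV.
  by rewrite -[A](conjgK Q); apply: (hm m) => //; exact: cong_refl.
have : [~ (h ^ P), (g ^ P)]%g 0 0 + [~ (h ^ P), (g ^ P)]%g 1 1 != 2%:R.
  by rewrite -conjRg SL2_trJ.
rewrite (commg_trace_diag _ (mulfV l0) E00 E01 E10 E11) => bc0.
have [hb hc] : (h ^ P)%g 0 1 != 0 /\ (h ^ P)%g 1 0 != 0.
  by split; apply: contra_neq bc0 => ->; rewrite ?(mulr0, mul0r) subr0.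
have : dense_cong [set x | D (x ^ P^-1)%g].
  apply: (@dense_of_diag _ _ [set x | L (x ^ P^-1)%g] _ (g ^ P)%g (h ^ P)%g l) => //.
  - exact: transport.
  - split=> [|x y|x] /=; first by rewrite conj1g.
      by rewrite conjMg; exact: DM.
    by rewrite conjVg; exact: DV.
  - move=> a x N /= La Dx; have [n Nn Dn] := rec _ _ N La Dx.
    by exists n => //=; rewrite conjJg conjXg.
  - by rewrite /= conjgK.
  - by rewrite /= conjgK.
move=> /transport /(_ P); congr (dense_cong _).
by apply/seteqP; split=> x /=; rewrite conjgK.
Qed.

End Hyperbolic.

(** * The p-adic topology through congruences *)

Section Topology.
Context (p : nat) (hp : prime p).
Local Notation Qp := (padic hp).
Local Notation S := (SL 2 (padic hp)).
Local Notation inO := (@inO p hp).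
Local Notation pi := (p%:R : Qp).

Lemma padic_ballE (x y : Qp) (n : nat) : padic_ball x n y <-> inO n (y - x).
Proof.
split=> [[z _ <-]|[z zE]]; first by exists z; rewrite addrC addKr exprnP.
by exists z => //; rewrite exprnP -zE addrC subrK.
Qed.

Lemma nbhs_cong (A : S) (U : set S) : nbhs A U ->
  exists n : nat, forall x : S, cong n x A -> U x.
Proof.
rewrite nbhsE => -[V [[B Bopen BV] VA] VU].
have BA : B A by move: VA; rewrite -BV.
have [P PA PB] : nbhs (A : 'M[Qp]_2) B by exact: open_nbhs_nbhs.
have ball i j : exists n : nat, forall x, inO n (x - A i j) -> P i j x.
  have [n _ hn] := PA i j; exists n => x hx; apply: hn.
  exact/padic_ballE.
have [a ha] := ball 0 0; have [b hb] := ball 0 1.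
have [c hc] := ball 1 0; have [d hd] := ball 1 1.
exists (a + b + c + d)%N => x xA; apply: VU; rewrite -BV; apply: PB => i j.
by case: (ord2P i) => ->; case: (ord2P j) => ->; [apply: ha|apply: hb|apply: hc|apply: hd];
  apply: inO_le (xA _ _); lia.
Qed.

Lemma open_cong (A : S) (n : nat) : open [set x : S | cong n x A].
Proof.
exists [set M : 'M[Qp]_2 | cong n M A] => //.
rewrite openE => M MA; exists (fun i j => padic_ball (M i j) n).
  by move=> i j; exists n.
move=> M' M'M; apply: cong_trans MA => i j; apply/padic_ballE; exact: M'M.
Qed.

Lemma dense_congP (L : set S) : dense L <-> dense_cong L.
Proof.
split=> [Ld A n|Ld O [A OA] Oopen].
  have [||x [xA Lx]] := Ld [set x | cong n x A].
  - by exists A; exact: cong_refl.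
  - exact: open_cong.
  by exists x.
have [n hn] : exists n : nat, forall x : S, cong n x A -> O x.
  by apply: nbhs_cong; exact: open_nbhs_nbhs.
by have [x Lx xA] := Ld A n; exists x; split=> //; exact: hn.
Qed.

Lemma cong_separated (x y : S) : x <> y -> exists n : nat, forall x' : S, cong n x' x -> x' <> y.
Proof.
move=> xy; have [i [j ij]] : exists i j, x i j != y i j.
  apply: contrapT => nij; apply: xy.
  have e i j : x i j = y i j.
    by apply/eqP/negPn/negP => ij; apply: nij; exists i, j.
  exact: SL2_eq.
have [n hn] := inO_separated ij; exists n => x' x'x e.
by have := hn _ (x'x i j); rewrite e eqxx.
Qed.

Lemma exists_small_noncommuting (d : S) (n : nat) :
  ~ [/\ d 0 1 = 0, d 1 0 = 0 & d 0 0 = d 1 1] ->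
  exists u : S, cong n u (1%g : S) /\ ~ commute u d.
Proof.
move=> nscal; pose t : Qp := pi ^ n%:Z.
have t0 : t != 0 by rewrite expfz_neq0 ?pnat_neq0.
have [|u [u00 u01 u10 u11]] := @SL2_ex _ (1 : Qp) t 0 1; first by ring.
have [|l [l00 l01 l10 l11]] := @SL2_ex _ (1 : Qp) 0 t 1; first by ring.
have tn : inO n t by exact: inO_piz.
have [uc|uc] := pselect (commute u d); last first.
  exists u; split=> // i j.
  by case: (ord2P i) => ->; case: (ord2P j) => ->; rewrite SL2_1 ?u00 ?u01 ?u10 ?u11 /=
    ?subrr ?subr0 //; exact: inO0.
exists l; split=> [i j|lc].
  by case: (ord2P i) => ->; case: (ord2P j) => ->; rewrite SL2_1 ?l00 ?l01 ?l10 ?l11 /=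
    ?subrr ?subr0 //; exact: inO0.
apply: nscal.
have e1 := congr1 (fun x : S => x 0 0) uc.
have e2 := congr1 (fun x : S => x 0 1) uc.
have e3 := congr1 (fun x : S => x 1 1) lc.
move: e1 e2 e3; rewrite !SL2M u00 u01 u10 u11 l01 l10 l11.
rewrite !(mul1r, mulr1, mul0r, mulr0, addr0, add0r) => e1 e2 e3; split.
- have /eqP : t * d 0 1 = 0 by apply: (addIr (d 1 1)); rewrite e3 add0r.
  by rewrite mulf_eq0 (negPf t0) => /eqP.
- have /eqP : t * d 1 0 = 0 by apply: (addrI (d 0 0)); rewrite e1 addr0.
  by rewrite mulf_eq0 (negPf t0) => /eqP.
- apply: (mulfI t0); apply: (addrI (d 0 1)).
  by rewrite e2 addrC mulrC.
Qed.

(** The centraliser of d contains no neighbourhood of 1. For u small and outside it,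
    both conditions on the commutator hold at u and are open, so that the density of
    L provides g near u. *)
Lemma small_commutator (L : set S) (d : S) (n : nat) : dense_cong L ->
  ~ [/\ d 0 1 = 0, d 1 0 = 0 & d 0 0 = d 1 1] ->
  exists g, [/\ L g, cong n [~ g, d]%g (1%g : S) & [~ g, d]%g <> 1%g].
Proof.
move=> Ldense nscal; have [m hm] := congR 1%g d n.
have [u [um uc]] := exists_small_noncommuting m nscal.
have ud : [~ u, d]%g <> 1%g by move/eqP/commgP.
have [N hN] := cong_separated ud; have [M hM] := congR u d N.
have [g Lg gu] := Ldense u (m + M)%N.
exists g; split=> //; last first.
  by apply: hN; apply: (hM (m + M)%N) => //; [lia|exact: cong_refl].
rewrite -(comm1g d); apply: (hm m) => //; last exact: cong_refl.
by apply: cong_trans um; apply: cong_le gu; lia.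
Qed.

End Topology.

(** * Dense projections *)

Section DenseProjection.
Context (p q : nat) (hp : prime p) (hq : prime q) (G : groupType).
Local Notation S := (SL 2 (padic hp)).
Local Notation S' := (SL 2 (padic hq)).
Context (f : G -> S) (f' : G -> S').

(** Stated for two homomorphisms rather than for the two projections of a product, in
    order to apply it to each factor. If f d were scalar for all d in Delta, some
    f' d would not be; the commutators of d with elements x of Gamma such that f' x
    is small would then be nontrivial elements of Gamma arbitrarily close to 1. *)
Lemma dense_projection (Gamma Delta : groupClosed G) :
  {morph f : x y / (x * y)%g} -> {morph f' : x y / (x * y)%g} ->
  (forall x y, f x = f y -> f' x = f' y -> x = y) ->
  {subset Delta <= Gamma} ->
  (exists n : nat, forall x, x \in Gamma -> cong n (f x) (1%g : S) ->
    cong n (f' x) (1%g : S') -> x = 1%g) ->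
  dense [set f x | x in [set` Gamma]] -> dense [set f' x | x in [set` Gamma]] ->
  ~ central Gamma Delta -> lV_boomerang Gamma Delta ->
  dense [set f x | x in [set` Delta]].
Proof.
move=> fM f'M ff'_inj DeltaGamma [n discr] fGamma f'Gamma ncentral boom.
have f1 : f 1%g = 1%g by apply: (mulgI (f 1%g)); rewrite -fM !mulg1.
have fV x : f x^-1%g = (f x)^-1%g by apply/esym/mulg1_eq; rewrite -fM mulgV.
have f'1 : f' 1%g = 1%g by apply: (mulgI (f' 1%g)); rewrite -f'M !mulg1.
have f'V x : f' x^-1%g = (f' x)^-1%g by apply/esym/mulg1_eq; rewrite -f'M mulgV.
have fX x k : f (x ^+ k)%g = (f x ^+ k)%g.
  by elim: k => [|k IH]; rewrite ?expg0 // !expgS fM IH.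
have scalar_central (r : nat) (hr : prime r) (a b : SL 2 (padic hr)) :
    [/\ a 0 1 = 0, a 1 0 = 0 & a 0 0 = a 1 1] -> commute a b.
  move=> [a01 a10 a00]; apply: SL2_eq; rewrite !SL2M.
  - by rewrite a01 a10; ring.
  - by rewrite a01 a00; ring.
  - by rewrite a10 a00; ring.
  - by rewrite a01 a10; ring.
have [d [dDelta dnscal]] : exists d, d \in Delta /\
    ~ [/\ f d 0 1 = 0, f d 1 0 = 0 & f d 0 0 = f d 1 1].
  apply: contrapT => noD; apply: ncentral => d g dD gG.
  have ds : [/\ f d 0 1 = 0, f d 1 0 = 0 & f d 0 0 = f d 1 1].
    by apply: contrapT => ds; apply: noD; exists d.
  have fdC x : commute (f d) x by exact: scalar_central.
  apply: ff'_inj; rewrite ?fM ?f'M; first exact: fdC.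
  apply: scalar_central; apply: contrapT => d's.
  have [_ [[x xG <-] xn x1]] := small_commutator n (iffLR (dense_congP _) f'Gamma) d's.
  have xdE : f' [~ x, d]%g = [~ f' x, f' d]%g by rewrite !commgEl !conjgE !(f'M, f'V).
  apply: x1; rewrite -xdE (_ : [~ x, d]%g = 1%g) ?f'1//.
  have dG := DeltaGamma _ dD.
  apply: discr; last by rewrite xdE.
    by rewrite commgEl conjgE !gpredM// gpredV.
  have -> : f [~ x, d]%g = 1%g.
    rewrite !commgEl !conjgE !(fM, fV); apply/eqP.
    by rewrite -conjgE -commgEl; apply/commgP/commute_sym.
  exact: cong_refl.
apply/dense_congP.
apply: (@dense_of_nonscalar _ _ [set f x | x in [set` Gamma]] _ (f d)) => //.
- exact/dense_congP.
- split.
  + by exists 1%g => //=; rewrite gpred1.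
  + by move=> _ _ [x /= xD <-] [y /= yD <-]; exists (x * y)%g => //=; rewrite gpredM.
  + by move=> _ [x /= xD <-]; exists x^-1%g => //=; rewrite gpredV.
- move=> _ _ N [g /= gG <-] [x /= xD <-].
  have inf : infinite_set [set k : nat | (1 <= k)%N /\
      [set x] `<=` [set (g ^+ k * d * g ^- k)%g | d in [set` Delta]]].
    by apply: boom => // _ ->.
  apply: contrapT => noN; apply: inf.
  apply: (sub_finite_set _ (finite_II N.+1)) => k [_ kx] /=.
  rewrite ltnS leqNgt; apply/negP => Nk; apply: noN; exists k => //.
  have [y yD yx] := kx x erefl.
  exists y => //; rewrite -fX -yx !(fM, fV) conjgE !mulgA mulVg mul1g.
  by rewrite -!mulgA mulVg mulg1.
- by exists d.
Qed.

End DenseProjection.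

Theorem corollary1p10 (R : realType) (p q : nat)
    (hp : prime p) (hq : prime q)
    (Gamma Delta : groupClosed (SL 2 (padic hp) * SL 2 (padic hq))%type)
    (Gamma_lattice : is_lattice R Gamma)
    (Gamma_irreducible : irreducible Gamma)
    (Delta_Gamma : {subset Delta <= Gamma})
    (Delta_noncentral : ~ central Gamma Delta)
    (Delta_boomerang : lV_boomerang Gamma Delta) :
  dense [set g.1 | g in [set` Delta]] /\ dense [set g.2 | g in [set` Delta]].
Proof.
have [Gamma_discrete _] := Gamma_lattice; have [dense1 dense2] := Gamma_irreducible.
have [n discr] : exists n : nat, forall x, x \in Gamma ->
    cong n x.1 (1%g : SL 2 (padic hp)) -> cong n x.2 (1%g : SL 2 (padic hq)) -> x = 1%g.
  have [_ [V [[U U'] /= [U1 U'1] UV] V1]] : isolated [set` Gamma] 1%g.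
    by apply: Gamma_discrete => /=; rewrite gpred1.
  have [n hn] := nbhs_cong U1; have [n' hn'] := nbhs_cong U'1.
  exists (n + n')%N => x xG x1 x2.
  have : (V `&` [set` Gamma]) x.
    split=> //; apply: UV; split=> /=; [apply: hn|apply: hn'].
      by apply: cong_le x1; lia.
    by apply: cong_le x2; lia.
  by rewrite V1.
split.
- apply: (@dense_projection _ _ hp hq _ fst snd Gamma) => //.
  + by move=> [? ?] [? ?] /= -> ->.
  + by exists n.
- apply: (@dense_projection _ _ hq hp _ snd fst Gamma) => //.
  + by move=> [? ?] [? ?] /= -> ->.
  + by exists n => x xG x2 x1; exact: discr.
Qed.
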